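(* Let $a>b>0$ and consider the magic billiard with half-turn about the center within the ellipse $\mathcal{E}:\ \frac{x^2}{a}+\frac{y^2}{b}=1$. Let $n$ be a positive integer. The trajectories of this billiard with caustic $\mathcal{C}_\beta$ are $n$-periodic if and only if there exists a pair of real polynomials $p_{d_1}$, $q_{d_2}$ of degrees $d_1$, $d_2$ respectively, satisfying the following: (a) if $n=2m$ is even, then $d_1=m$, $d_2=m-2$, and $$p_m^2(s)-s\left(s-\frac1a\right)\left(s-\frac1b\right)\left(s-\frac1\beta\right)q_{m-2}^2(s)=1;$$ (b) if $n=2m+1$ is odd, then $d_1=m$, $d_2=m-1$, and $$s\,p_m^2(s)-\left(s-\frac1a\right)\left(s-\frac1b\right)\left(s-\frac1\beta\right)q_{m-1}^2(s)=1.$$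
   Context: Confocal family: $\mathcal{C}_\lambda:\ \frac{x^2}{a-\lambda}+\frac{y^2}{b-\lambda}=1$, so $\mathcal{E}=\mathcal{C}_0$; $\mathcal{C}_\lambda$ is an ellipse for $\lambda<b$ and a hyperbola for $b<\lambda<a$. Magic billiard with half-turn about the center: let $D$ be the closed domain bounded by $\mathcal{E}$, and let $\varphi$ be the half-turn about the center of $\mathcal{E}$, $\varphi(x,y)=(-x,-y)$. A particle moves with unit speed along straight segments inside $D$. When it hits $\mathcal{E}$ at a point $A$ with velocity $\vec v$, it continues from the point $\varphi(A)$ with velocity $\varphi^*(\vec v)=d\varphi(\rho_A(\vec v))$, where $\rho_A$ is the usual billiard reflection (reflection of vectors with respect to the tangent line to $\mathcal{E}$ at $A$). Caustic: each trajectory has a unique conic $\mathcal{C}_\beta$ of the confocal family such that the lines containing the segments of the trajectory are all tangent to $\mathcal{C}_\beta$; it is called the caustic of the trajectory. The caustic is nondegenerate, i.e. $\beta\in(0,b)\cup(b,a)$. $n$-periodic: after $n$ consecutive hits at the boundary the particle returns to its initial position and velocity ($n$ is not required to be the minimal such number). A polynomial of negative degree is understood to be the zero polynomial. *)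

(* Defs.v *)
From HB Require Import structures.
From mathcomp Require Import all_boot all_order all_algebra.
From mathcomp Require Import reals.

Set Implicit Arguments.
Unset Strict Implicit.
Unset Printing Implicit Defensive.

Import Order.TTheory GRing.Theory Num.Theory.
Local Open Scope ring_scope.

Definition dot (R : realType) (u v : 'rV[R]_2) : R :=
  \sum_(i < 2) u 0 i * v 0 i.

Definition on_ellipse (R : realType) (a b : R) (P : 'rV[R]_2) : Prop :=
  P 0 0 ^+ 2 / a + P 0 1 ^+ 2 / b = 1.

Definition in_domain (R : realType) (a b : R) (P : 'rV[R]_2) : Prop :=
  P 0 0 ^+ 2 / a + P 0 1 ^+ 2 / b <= 1.

(* C_l is the conic x^2/(a - l) + y^2/(b - l) = 1, for l different from a, b.
   The line {P + t u} is the tangent of C_l at a point [X : Y : Z] of the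
   projective closure of C_l. The points with Z = 0 make the asymptotes of a
   hyperbola tangent lines (at infinity): a billiard trajectory with a
   hyperbolic caustic may contain a segment lying on an asymptote. *)
Definition tangent_confocal (R : realType) (a b l : R)
    (P u : 'rV[R]_2) : Prop :=
  exists X Y Z : R,
    [/\ ~ [/\ X = 0, Y = 0 & Z = 0],
        X ^+ 2 / (a - l) + Y ^+ 2 / (b - l) = Z ^+ 2
      & forall t : R, let Q := P + t *: u in
          X * Q 0 0 / (a - l) + Y * Q 0 1 / (b - l) = Z].

(* Half of the gradient of x^2/a + y^2/b at A. *)
Definition ellipse_normal (R : realType) (a b : R) (A : 'rV[R]_2) : 'rV[R]_2 :=
  \row_(i < 2) (if i == 0 then A 0 0 / a else A 0 1 / b).

Definition reflect_at (R : realType) (a b : R) (A v : 'rV[R]_2) : 'rV[R]_2 :=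
  let N := ellipse_normal a b A in v - (2 * dot v N / dot N N) *: N.

(* This map is linear, so it is also its own differential. *)
Definition half_turn (R : realType) (P : 'rV[R]_2) : 'rV[R]_2 := - P.

(* x 0, v 0: initial position (anywhere in the closed domain) and velocity;
   x k, v k for k > 0: position and velocity just after the k-th hit.
   By convexity the ray from x k meets the ellipse for at most one t > 0. *)
Definition magic_trajectory (R : realType) (a b : R)
    (x v : nat -> 'rV[R]_2) : Prop :=
  [/\ in_domain a b (x 0%N),
      dot (v 0%N) (v 0%N) = 1
    & forall k : nat, exists2 t : R, 0 < t &
        let A := x k + t *: v k in
        [/\ on_ellipse a b A,
            x k.+1 = half_turn A
          & v k.+1 = half_turn (reflect_at a b A (v k))]].

Definition has_caustic (R : realType) (a b beta : R)
    (x v : nat -> 'rV[R]_2) : Prop :=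
  forall k : nat, tangent_confocal a b beta (x k) (v k).

(* After the n-th hit the particle passes again through x 0 with velocity v 0.
   If x 0 is on the ellipse then t = 0; t > 0 when x 0 is interior. *)
Definition n_periodic (R : realType) (n : nat) (x v : nat -> 'rV[R]_2) : Prop :=
  v n = v 0%N /\ exists2 t : R, 0 <= t & x 0%N = x n + t *: v n.

Definition has_degree (R : realType) (p : {poly R}) (d : int) : Prop :=
  if (0 <= d)%R then (size p)%:Z = d + 1 else p = 0.

(* Main.v *)
Require Import Defs.
From HB Require Import structures.
From mathcomp Require Import all_boot all_order all_algebra.
From mathcomp Require Import reals.
From mathcomp Require Import ring lra zify.

Set Implicit Arguments.
Unset Strict Implicit.
Unset Printing Implicit Defensive.

Import Order.TTheory GRing.Theory Num.Theory.
Local Open Scope ring_scope.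

(* Up to signs the trajectory is an ordinary billiard trajectory, and a bounce
   acts on the Lax matrix [lax] of a line (a 2x2 polynomial matrix in the
   parameter l of the confocal family, of square
   C(l) = (a - l) (b - l) (beta - l)) by conjugation with a matrix [step] that
   is polynomial in l, with determinant l^2.

   The product of the n bounces of an n-periodic trajectory, completed by a
   shear, commutes with the initial Lax matrix L, hence it is P + Q L with
   P^2 - Q^2 C = l^(2n). Its action at l = a and l = b gives P(a) = a^n and
   P(b) = b^n, which together with P(0) > 0 and unique factorization forces
   P = p^2 + q^2 C and Q = 2 p q with p^2 - q^2 C = l^n; then s = 1/l.

   Conversely such a pair gives a matrix P + Q L, which is divisible on the
   right by the first bounce since its image at l = 0 is the right eigenline;
   inductively it is divisible by the product of the n bounces. The quotient is
   a constant unipotent matrix by degree, and evaluation at l = a and l = b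
   shows that the trajectory closes up. *)

(** * Two by two matrices *)

Section TwoByTwo.
Variable K : comNzRingType.
Implicit Types (p q r s t : K) (M N : 'M[K]_2).

Definition mx2 p q r s : 'M[K]_2 :=
  \matrix_(i, j) (if i == 0 then if j == 0 then p else q
                  else if j == 0 then r else s).

Lemma mx2_eta M : M = mx2 (M 0 0) (M 0 1) (M 1 0) (M 1 1).
Proof.
apply/matrixP => i j; rewrite mxE.
by case: i => [[|[|//]] hi]; case: j => [[|[|//]] hj] /=; congr (M _ _);
  apply: val_inj.
Qed.

Lemma mx2_inj p q r s p' q' r' s' :
  mx2 p q r s = mx2 p' q' r' s' -> [/\ p = p', q = q', r = r' & s = s'].
Proof.
move=> /matrixP E.
by move: (E 0 0) (E 0 1) (E 1 0) (E 1 1); rewrite !mxE /=.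
Qed.

Lemma mul_mx2 p q r s p' q' r' s' :
  mx2 p q r s *m mx2 p' q' r' s' =
  mx2 (p * p' + q * r') (p * q' + q * s') (r * p' + s * r') (r * q' + s * s').
Proof.
by rewrite [LHS]mx2_eta; congr mx2; rewrite !mxE big_ord_recl big_ord1 !mxE.
Qed.

Lemma add_mx2 p q r s p' q' r' s' :
  mx2 p q r s + mx2 p' q' r' s' = mx2 (p + p') (q + q') (r + r') (s + s').
Proof. by rewrite [LHS]mx2_eta; congr mx2; rewrite !mxE. Qed.

Lemma opp_mx2 p q r s : - mx2 p q r s = mx2 (- p) (- q) (- r) (- s).
Proof. by rewrite [LHS]mx2_eta; congr mx2; rewrite !mxE. Qed.

Lemma scale_mx2 t p q r s :
  t *: mx2 p q r s = mx2 (t * p) (t * q) (t * r) (t * s).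
Proof. by rewrite [LHS]mx2_eta; congr mx2; rewrite !mxE. Qed.

Lemma scalar_mx2 t : t%:M = mx2 t 0 0 t :> 'M[K]_2.
Proof. by rewrite [LHS]mx2_eta; congr mx2; rewrite !mxE. Qed.

Definition mx2E :=
  (mul_mx2, add_mx2, opp_mx2, scale_mx2, scalar_mx2).

Definition adj2 M := mx2 (M 1 1) (- M 0 1) (- M 1 0) (M 0 0).

Definition det2 M := M 0 0 * M 1 1 - M 0 1 * M 1 0.

Lemma adj2E p q r s : adj2 (mx2 p q r s) = mx2 s (- q) (- r) p.
Proof. by rewrite /adj2 !mxE. Qed.

Lemma det2E p q r s : det2 (mx2 p q r s) = p * s - q * r.
Proof. by rewrite /det2 !mxE. Qed.

Lemma mul_mx2_adj M : M *m adj2 M = (det2 M)%:M.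
Proof.
by rewrite [M]mx2_eta adj2E det2E !mx2E; congr mx2; ring.
Qed.

Lemma mul_adj2_mx M : adj2 M *m M = (det2 M)%:M.
Proof.
by rewrite [M]mx2_eta adj2E det2E !mx2E; congr mx2; ring.
Qed.

Lemma adj2M M N : adj2 (M *m N) = adj2 N *m adj2 M.
Proof.
by rewrite [M]mx2_eta [N]mx2_eta !(mul_mx2, adj2E); congr mx2; ring.
Qed.

Lemma det2M M N : det2 (M *m N) = det2 M * det2 N.
Proof.
by rewrite [M]mx2_eta [N]mx2_eta !(mul_mx2, det2E); ring.
Qed.

(** Cayley-Hamilton; for [M = P + Q L] below it reads [M^2 = 2 P M - l^(2 n)]. *)
Lemma mx2_sqr M :
  M *m M = (M 0 0 + M 1 1) *: M - (det2 M)%:M.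
Proof.
by rewrite {1 2 5}[M]mx2_eta /det2 !mx2E; congr mx2; ring.
Qed.

End TwoByTwo.

(** * The Lax matrix of a line *)

Section LaxPair.
Variable R : realType.
Implicit Types (a b c t : R) (x v N : 'rV[R]_2).

(** The polar form of [x^2/(a - l) + y^2/(b - l)], multiplied by [(a - l) (b - l)]; ['X] stands for
    [l]. *)
Definition confocal_form a b x v : {poly R} :=
  (x 0 0 * v 0 0)%:P * (b%:P - 'X) + (x 0 1 * v 0 1)%:P * (a%:P - 'X).

Definition confocal_cubic a b beta : {poly R} :=
  (a%:P - 'X) * (b%:P - 'X) * (beta%:P - 'X).

(** On the line [x + t v] the equation of [C_l], cleared of denominators, is quadratic in [t]. Its
    coefficients are arranged here with trace zero, so that minus the determinant is a quarter of
    the discriminant. *)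
Definition lax a b x v : 'M[{poly R}]_2 :=
  mx2 (- confocal_form a b x v)
      (confocal_form a b x x - (a%:P - 'X) * (b%:P - 'X))
      (- confocal_form a b v v) (confocal_form a b x v).

Definition shear t : 'M[{poly R}]_2 := mx2 1 t%:P 0 1.

Lemma lax_shear a b t x v :
  shear t *m lax a b x v = lax a b (x + t *: v) v *m shear t.
Proof.
by rewrite /lax /shear /confocal_form !mx2E !mxE; congr mx2; ring.
Qed.

(** At a hit point [x = (a N_1, b N_2)], its value at [l = a] (resp. [l = b]) sends the first (resp.
    second) coordinates of [x] and [v] to [l] times those of [- x] and [c *: N - v]. *)
Definition kick c : 'M[{poly R}]_2 := mx2 (- 'X) 0 c%:P (- 'X).

Lemma dotE x v : dot x v = x 0 0 * v 0 0 + x 0 1 * v 0 1.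
Proof.
rewrite /dot big_ord_recl big_ord1.
by have -> : lift ord0 ord0 = 1 :> 'I_2 by apply: val_inj.
Qed.

(** Entrywise, the difference of the two sides is a multiple of one of two relations: [x] is on the
    ellipse, and [c] is the coefficient of the reflection. *)
Lemma lax_kick a b c x v N :
    x 0 0 = a * N 0 0 -> x 0 1 = b * N 0 1 ->
    a * N 0 0 ^+ 2 + b * N 0 1 ^+ 2 = 1 ->
    c * dot N N = 2 * dot v N ->
  kick c *m lax a b x v = lax a b (- x) (c *: N - v) *m kick c.
Proof.
rewrite !dotE => x0 x1 /eqP; rewrite -subr_eq0 => /eqP/(congr1 polyC) hN.
move=> /eqP; rewrite -subr_eq0 => /eqP/(congr1 polyC) hc.
rewrite polyC0 in hN hc.
rewrite /lax /kick /confocal_form !mx2E !mxE x0 x1.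
congr mx2; apply/eqP; rewrite -subr_eq0; apply/eqP.
- transitivity (- c%:P * (a%:P - 'X) * (b%:P - 'X) *
    (a * N 0 0 ^+ 2 + b * N 0 1 ^+ 2 - 1)%:P); last by rewrite hN mulr0.
  by ring.
- by ring.
- transitivity (c%:P * (a%:P - 'X) * (b%:P - 'X) *
    (c * (N 0 0 * N 0 0 + N 0 1 * N 0 1) -
      2 * (v 0 0 * N 0 0 + v 0 1 * N 0 1))%:P); last by rewrite hc mulr0.
  by ring.
- transitivity (c%:P * (a%:P - 'X) * (b%:P - 'X) *
    (a * N 0 0 ^+ 2 + b * N 0 1 ^+ 2 - 1)%:P); last by rewrite hN mulr0.
  by ring.
Qed.

(* The caustic parameter is the root other than a and b of
   [- det (lax a b x v)]. *)
Definition caustic_level a b x v : R :=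
  b * v 0 0 ^+ 2 + a * v 0 1 ^+ 2 - (x 0 0 * v 0 1 - x 0 1 * v 0 0) ^+ 2.

Lemma det2_lax a b x v : dot v v = 1 ->
  det2 (lax a b x v) = - confocal_cubic a b (caustic_level a b x v).
Proof.
rewrite dotE => /eqP; rewrite -subr_eq0 => /eqP/(congr1 polyC) hv.
rewrite polyC0 in hv.
rewrite /lax det2E /confocal_form /confocal_cubic /caustic_level.
apply/eqP; rewrite -subr_eq0; apply/eqP.
transitivity ((a%:P - 'X) * (b%:P - 'X) * 'X *
  (v 0 0 * v 0 0 + v 0 1 * v 0 1 - 1)%:P); last by rewrite hv mulr0.
by ring.
Qed.

(* The line {x + t v} corresponds, up to scale, to
   (X / (a - l), Y / (b - l), Z) = (v_2, - v_1, x_1 v_2 - x_2 v_1). *)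
Lemma tangent_confocalP a b l x v : l != a -> l != b -> dot v v = 1 ->
  tangent_confocal a b l x v <-> caustic_level a b x v = l.
Proof.
move=> la lb; rewrite dotE => hv.
have al : a - l != 0 by rewrite subr_eq0 eq_sym.
have bl : b - l != 0 by rewrite subr_eq0 eq_sym.
rewrite /caustic_level; set J := x 0 0 * v 0 1 - x 0 1 * v 0 0.
split=> [[X [Y [Z [nz hC hL]]]]|hJ].
- have := hL 0; have := hL 1; rewrite /= !mxE => h1 h0.
  set X' := X / (a - l); set Y' := Y / (b - l).
  have eX : X = X' * (a - l) by rewrite /X' divfK.
  have eY : Y = Y' * (b - l) by rewrite /Y' divfK.
  have h0' : X' * x 0 0 + Y' * x 0 1 = Z by rewrite -h0 /X' /Y'; ring.
  have h1' : X' * v 0 0 + Y' * v 0 1 = 0.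
    by move: h1; rewrite -h0 /X' /Y' => /eqP; rewrite -subr_eq0 => /eqP <-;
      ring.
  have hC' : X' ^+ 2 * (a - l) + Y' ^+ 2 * (b - l) = Z ^+ 2.
    by rewrite -hC /X' /Y'; field; rewrite al bl.
  (* [(X', Y')] is orthogonal to the unit vector [v], hence it is [k] times [v] turned by a right
     angle. *)
  set k := X' * v 0 1 - Y' * v 0 0.
  have kX : X' = k * v 0 1.
    transitivity (X' * (v 0 0 * v 0 0 + v 0 1 * v 0 1));
      first by rewrite hv mulr1.
    transitivity (k * v 0 1 + v 0 0 * (X' * v 0 0 + Y' * v 0 1)).
      by rewrite /k; ring.
    by rewrite h1' mulr0 addr0.
  have kY : Y' = - k * v 0 0.
    transitivity (Y' * (v 0 0 * v 0 0 + v 0 1 * v 0 1));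
      first by rewrite hv mulr1.
    transitivity (- k * v 0 0 + v 0 1 * (X' * v 0 0 + Y' * v 0 1)).
      by rewrite /k; ring.
    by rewrite h1' mulr0 addr0.
  have kZ : Z = k * J by rewrite -h0' kX kY /J; ring.
  have k0 : k != 0.
    apply/negP => /eqP k0; apply: nz.
    by rewrite eX eY kX kY kZ k0 oppr0 !mul0r.
  have : k ^+ 2 * (b * v 0 0 ^+ 2 + a * v 0 1 ^+ 2 - J ^+ 2 - l) = 0.
    transitivity (X' ^+ 2 * (a - l) + Y' ^+ 2 * (b - l) - Z ^+ 2 +
      k ^+ 2 * l * (v 0 0 * v 0 0 + v 0 1 * v 0 1 - 1)).
      by rewrite kX kY kZ; ring.
    by rewrite hC' hv !subrr mulr0 addr0.
  by move/eqP; rewrite mulf_eq0 expf_eq0 (negPf k0) /= subr_eq0 => /eqP.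
- exists (v 0 1 * (a - l)), (- v 0 0 * (b - l)), J; split.
  + case=> /eqP; rewrite mulf_eq0 (negPf al) orbF => /eqP v1.
    move=> /eqP; rewrite mulf_eq0 oppr_eq0 (negPf bl) orbF => /eqP v0 _.
    by move: hv; rewrite v0 v1 !mulr0 addr0 => /eqP; rewrite eq_sym oner_eq0.
  + transitivity (b * v 0 0 ^+ 2 + a * v 0 1 ^+ 2 -
      l * (v 0 0 * v 0 0 + v 0 1 * v 0 1)); first by field; rewrite al bl.
    by rewrite hv -[in l * 1]hJ; ring.
  + by move=> t; rewrite /= !mxE /J; field; rewrite al bl.
Qed.

End LaxPair.

(** * From commuting matrices to the Pell equation *)

Section SquareCofactors.
Variable F : fieldType.
Implicit Types p q r f g h : {poly F}.

(** With [d] the gcd of [f] and [q] and [f = f1 d], the polynomials [f1] and [d] divide each other: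
    [f1] is coprime to [q / d] and to [h], while [d] is coprime to [g]. *)
Lemma coprime_mul_sqr f g q h :
    f * g = q ^+ 2 * h -> coprimep f g -> coprimep f h -> f != 0 ->
  exists k d r, f = k *: d ^+ 2 /\ q = d * r.
Proof.
move=> E cfg cfh f0; set d := gcdp f q.
have d0 : d != 0 by rewrite gcdp_eq0 (negPf f0).
pose f1 := f %/ d; pose q1 := q %/ d.
have ef : f = f1 * d by rewrite divpK // dvdp_gcdl.
have eq : q = q1 * d by rewrite divpK // dvdp_gcdr.
have c1 : coprimep f1 q1 by apply: coprimep_div_gcd; rewrite f0.
have E1 : f1 * g = d * (q1 ^+ 2 * h).
  apply: (mulfI d0); transitivity (f * g); first by rewrite ef; ring.
  by rewrite E eq; ring.
have f1d : f1 %| d.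
  have : f1 %| d * (q1 ^+ 2 * h) by rewrite -E1 dvdp_mulr.
  rewrite Gauss_dvdpl // coprimepMr coprimep_expr //=.
  by apply: coprimep_dvdr cfh; rewrite ef dvdp_mulr.
have df1 : d %| f1.
  have : d %| f1 * g by rewrite E1 dvdp_mulr.
  by rewrite Gauss_dvdpl //; apply: coprimep_dvdr cfg; rewrite ef dvdp_mull.
have /eqpfP e1 : f1 %= d by rewrite /eqp f1d.
exists (lead_coef f1 / lead_coef d), d, q1; split; last by rewrite mulrC.
by rewrite {1}ef {1}e1 -scalerAl.
Qed.

(** Over the fraction field, a matrix commuting with a nonscalar 2x2 matrix is affine in it;
    coprimality of [k] and [g] makes the coefficients polynomial. *)
Lemma commutant_mx2 (V : 'M[{poly F}]_2) g h k :
    (2 : F) != 0 -> k != 0 -> coprimep k g ->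
    V *m mx2 (- g) h (- k) g = mx2 (- g) h (- k) g *m V ->
  exists P Q, V = P%:M + Q *: mx2 (- g) h (- k) g.
Proof.
move=> F2 k0 ckg; rewrite [V]mx2_eta.
move: (V 0 0) (V 0 1) (V 1 0) (V 1 1) => p q r s.
rewrite !mul_mx2 => /mx2_inj[E00 _ E10 _].
have e1 : q * k = - h * r.
  by apply/eqP; rewrite -subr_eq0 -oppr_eq0 opprB; apply/eqP;
     move/eqP: E00; rewrite -subr_eq0 => /eqP <-; ring.
have e2 : g * (2%:P * r) = k * (p - s).
  by apply/eqP; rewrite -subr_eq0 -oppr_eq0 opprB; apply/eqP;
     move/eqP: E10; rewrite -subr_eq0 => /eqP <-; ring.
have : k %| g * (2%:P * r) by rewrite e2 dvdp_mulr.
rewrite Gauss_dvdpr // mul_polyC dvdpZr // => /dvdpP[Q er].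
exists (p - Q * g), (- Q); rewrite !mx2E; congr mx2.
- by ring.
- by apply: (mulIf k0); rewrite e1 er; ring.
- by rewrite er; ring.
- apply: (mulfI k0); transitivity (k * p - k * (p - s)); first by ring.
  by rewrite -e2 er; ring.
Qed.

End SquareCofactors.

(** * Factorization of [P^2 - l^(2 n)] into a Pell pair *)

Section PeriodicToPell.
Variables (R : realType) (a b beta : R).
Hypotheses (hb : 0 < b) (hab : b < a) (h0beta : 0 < beta) (hbeta : beta < a).

Let ha : 0 < a. Proof. exact: lt_trans hb hab. Qed.
Notation C := (confocal_cubic a b beta).

(** The size bounds say that [p^2] and [q^2 C] have degree at most [n]; [p.[0] != 0] becomes the
    exactness of the degree of [p] after [s = 1/l]. *)
Definition pell_pair n (p q : {poly R}) : Prop :=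
  [/\ p ^+ 2 - q ^+ 2 * C = 'X^n, p.[0] != 0,
      ((size p).*2 <= n.+2)%N & ((size q).*2 < n)%N].

Lemma horner_confocal_form (x v : 'rV[R]_2) l :
  (confocal_form a b x v).[l] =
  x 0 0 * v 0 0 * (b - l) + x 0 1 * v 0 1 * (a - l).
Proof. by rewrite /confocal_form !hornerE. Qed.

Lemma confocal_cubicE :
  C = - (('X - a%:P) * ('X - b%:P) * ('X - beta%:P)).
Proof. by rewrite /confocal_cubic; ring. Qed.

Lemma size_confocal_cubic : size C = 4%N.
Proof.
rewrite confocal_cubicE size_polyN size_Mmonic ?monicXsubC //; last first.
  by rewrite mulf_neq0 ?polyXsubC_eq0.
by rewrite size_Mmonic ?monicXsubC ?polyXsubC_eq0 // !size_XsubC.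
Qed.

Lemma size_sqr_poly (p : {poly R}) : size (p ^+ 2) = (size p).*2.-1.
Proof.
have [->|p0] := eqVneq p 0; first by rewrite expr0n size_poly0.
by rewrite expr2 size_mul // addnn.
Qed.

Lemma size_sqr_cubic (q : {poly R}) : q != 0 ->
  size (q ^+ 2 * C) = (size q).*2.+2.
Proof.
move=> q0; have C0 : C != 0 by rewrite -size_poly_eq0 size_confocal_cubic.
rewrite size_mul ?expf_neq0 // size_confocal_cubic size_sqr_poly.
by move: q0; rewrite -size_poly_gt0; clear; lia.
Qed.

(** A base point on the second axis and a velocity with nonzero coordinates make [k] and [g]
    coprime, and allow [P] to be evaluated at [a] and [b]. *)
Lemma pell_of_commutant n (x v : 'rV[R]_2) (V : 'M[{poly R}]_2) : (0 < n)%N ->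
    dot v v = 1 -> x 0 0 = 0 -> x 0 1 != 0 -> v 0 0 != 0 -> v 0 1 != 0 ->
    caustic_level a b x v = beta ->
    det2 V = 'X^(2 * n) ->
    V *m lax a b x v = lax a b x v *m V ->
    (V 1 0).[a] * x 0 0 + (V 1 1).[a] * v 0 0 = a ^+ n * v 0 0 ->
    (V 1 0).[b] * x 0 1 + (V 1 1).[b] * v 0 1 = b ^+ n * v 0 1 ->
    (forall i j m, (n < m)%N -> (V i j)`_m = 0) ->
    0 < (V 0 0).[0] + (V 1 1).[0] ->
  exists p q, pell_pair n p q.
Proof.
move=> n0 hv x0 x1 v0 v1 hlevel hdet hcomm hVa hVb hsize htr.
pose g := confocal_form a b x v; pose k := confocal_form a b v v.
pose rho := b * v 0 0 ^+ 2 + a * v 0 1 ^+ 2.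
have ek : k = - ('X - rho%:P).
  have /(congr1 polyC) : v 0 0 * v 0 0 + v 0 1 * v 0 1 = 1 by rewrite -dotE.
  rewrite polyC1 => hv1; transitivity
    (rho%:P - 'X * (v 0 0 * v 0 0 + v 0 1 * v 0 1)%:P); last first.
    by rewrite hv1; ring.
  by rewrite /k /rho /confocal_form; ring.
have k0 : k != 0 by rewrite ek oppr_eq0 polyXsubC_eq0.
have ckg : coprimep k g.
  rewrite ek -scaleN1r coprimepZl ?oppr_eq0 ?oner_eq0 // coprimep_sym
    coprimep_XsubC /root.
  have -> : g.[rho] = x 0 1 * v 0 1 * (a - rho).
    by rewrite horner_confocal_form x0; ring.
  rewrite !mulf_neq0 //.
  move: hv; rewrite dotE /rho => hv.
  have -> : a - (b * v 0 0 ^+ 2 + a * v 0 1 ^+ 2) = (a - b) * v 0 0 ^+ 2.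
    by rewrite -[X in X - _]mulr1 -hv; ring.
  by rewrite mulf_neq0 ?expf_neq0 // subr_eq0 gt_eqF.
have two : (2 : R) != 0 by rewrite pnatr_eq0.
have [P [Q eV]] := commutant_mx2 two k0 ckg hcomm.
have [V00 V10 V11] : [/\ V 0 0 = P - Q * g, V 1 0 = - (Q * k) & V 1 1 = P + Q
  * g].
  by rewrite eV !mxE /= !mulr1n !mulr0n; split; ring.
have pell : P ^+ 2 - Q ^+ 2 * C = 'X^(2 * n).
  have := det2_lax a b x hv; rewrite hlevel /lax det2E -/g -/k.
  set h := confocal_form a b x x - _ => eC.
  rewrite -hdet eV scalar_mx2 scale_mx2 add_mx2 det2E.
  transitivity (P ^+ 2 + Q ^+ 2 * (- C)); first by ring.
  by rewrite -eC /h; ring.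
have P0 : 0 < P.[0].
  have := htr; rewrite -hornerD V00 V11.
  have -> : P - Q * g + (P + Q * g) = 2%:P * P by ring.
  by rewrite hornerM hornerC pmulr_rgt0.
have an : 0 < a ^+ n by rewrite exprn_gt0.
have bn : 0 < b ^+ n by rewrite exprn_gt0.
(* The contributions of [Q] cancel, because the Lax matrix at [l = a] (resp. [l = b]) kills the
   vector of first (resp. second) coordinates. *)
have Pa : P.[a] = a ^+ n.
  apply: (mulIf v0); rewrite -hVa V11 hornerD hornerM.
  by rewrite horner_confocal_form x0; ring.
have Pb : P.[b] = b ^+ n.
  apply: (mulIf v1); rewrite -hVb V10 V11 hornerD hornerN !hornerM.
  by rewrite !horner_confocal_form x0; ring.
(* Here [f f' = Q^2 C], and [f], [f'] are coprime because they differ by [2 l^n] and [f.[0] != 0].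
   The aim is that [f] be a constant times a square. *)
pose f := P + 'X^n; pose f' := P - 'X^n.
have fE l : f.[l] = P.[l] + l ^+ n by rewrite /f !hornerE.
have fa : 0 < f.[a] by rewrite fE Pa addr_gt0.
have fb : 0 < f.[b] by rewrite fE Pb addr_gt0.
have f0 : 0 < f.[0] by rewrite fE expr0n -[n == 0%N]negbK -lt0n n0 addr0.
have fN0 : f != 0 by apply: contraTneq f0 => ->; rewrite horner0 ltxx.
have ff' : f * f' = Q ^+ 2 * C.
  transitivity (P ^+ 2 - 'X^(2 * n)); last by rewrite -pell; ring.
  by rewrite mulnC exprM /f /f'; ring.
have cff' : coprimep f f'.
  have -> : f' = 1 * f + (- 2) *: 'X^n by rewrite -mul_polyC /f /f'; ring.
  rewrite coprimep_addl_mul coprimepZr ?oppr_eq0 // coprimep_expr //.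
  by rewrite coprimepX /root gt_eqF.
have sizef : (size f <= n.+1)%N /\ (size f' <= n.+1)%N.
  have sP : (size P <= n.+1)%N.
    apply/leq_sizeP => j nj.
    (* [P] is half the trace of [V] and inherits its degree bound. *)
    have -> : P = (2^-1)%:P * (V 0 0 + V 1 1).
      have /(congr1 polyC) : 2 * 2^-1 = 1 :> R by rewrite mulfV.
      rewrite polyCM polyC1 V00 V11 => h2; transitivity (2%:P * (2^-1)%:P * P).
        by rewrite h2 mul1r.
      by ring.
    by rewrite coefCM coefD !hsize // addr0 mulr0.
  by split; apply: leq_trans (size_polyD _ _) _;
    rewrite ?size_polyN geq_max sP size_polyXn leqnn.
(* As [f] is positive at [a] and [b], the only factor it could share with [C] is ['X - beta]. *)
have cXa (F : {poly R}) : F.[a] != 0 -> F.[b] != 0 ->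
    coprimep F (- (('X - a%:P) * ('X - b%:P))).
  move=> Fa Fb; rewrite -scaleN1r coprimepZr ?oppr_eq0 ?oner_eq0 //.
  by rewrite coprimepMr !coprimep_XsubC /root Fa.
have [rb|nrb] := boolP (root f beta).
  (* The signs of [f] at [0] and [a] exclude this case. *)
  have /factor_theorem[F eF] := rb.
  have eF' : F * f' = Q ^+ 2 * (- (('X - a%:P) * ('X - b%:P))).
    apply: (@mulIf _ ('X - beta%:P)); first by rewrite polyXsubC_eq0.
    transitivity (f * f'); first by rewrite eF; ring.
    by rewrite ff' confocal_cubicE; ring.
  have cF : coprimep F (- (('X - a%:P) * ('X - b%:P))).
    by apply: cXa; [move: fa|move: fb]; rewrite eF hornerM;
       apply: contraTneq => ->; rewrite mul0r ltxx.
  have cFf' : coprimep F f'.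
    by apply: coprimep_dvdr cff'; rewrite eF dvdp_mulr.
  have FN0 : F != 0 by apply: contraNneq fN0 => F0; rewrite eF F0 mul0r.
  have [l [d [r [eFd _]]]] := coprime_mul_sqr eF' cFf' cF FN0.
  have fF y : f.[y] = l * d.[y] ^+ 2 * (y - beta).
    by rewrite eF hornerM eFd hornerZ horner_exp hornerXsubC.
  move: f0 fa; rewrite !fF => h0 h1.
  have hd0 := sqr_ge0 d.[0]; have hda := sqr_ge0 d.[a].
  have l0 : 0 < l.
    rewrite ltNge; apply/negP => l0; move: h1; rewrite ltNge => /negP; apply.
    by rewrite pmulr_lle0 ?subr_gt0 // mulr_le0_ge0.
  move: h0; rewrite ltNge => /negP[].
  by rewrite nmulr_lle0 ?subr_lt0 // mulr_ge0 // ltW.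
have cfC : coprimep f C.
  have -> : C = (- (('X - a%:P) * ('X - b%:P))) * ('X - beta%:P).
    by rewrite confocal_cubicE; ring.
  by rewrite coprimepMr cXa ?gt_eqF // coprimep_XsubC.
have [l [d [r [ef eQ]]]] := coprime_mul_sqr ff' cff' cfC fN0.
have l0 : 0 < l.
  have hd0 := sqr_ge0 d.[0]; rewrite ltNge; apply/negP => l0.
  move: f0; rewrite ef hornerZ horner_exp ltNge => /negP[].
  by rewrite mulr_le0_ge0.
have d0 : d != 0.
  by apply: contraNneq fN0 => dE; rewrite ef dE expr0n scaler0.
have ef' : l *: f' = r ^+ 2 * C.
  apply: (@mulfI _ (d ^+ 2)); first by rewrite expf_neq0.
  by rewrite mulrA -exprMn -eQ -ff' ef -scalerAr -scalerAl.
(* From [f = l d^2] and [l f' = r^2 C], the constants are those for which [p^2 = f / 2] and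
   [q^2 C = f' / 2]. *)
pose p := Num.sqrt (l / 2) *: d; pose q := (Num.sqrt (2 * l))^-1 *: r.
have ep : 2 *: p ^+ 2 = f.
  rewrite exprZn sqr_sqrtr ?divr_ge0 ?ltW // scalerA ef.
  by rewrite mulrC divfK.
have eq : 2 *: (q ^+ 2 * C) = f'.
  rewrite exprZn exprVn sqr_sqrtr ?mulr_ge0 ?ltW // -scalerAl -ef' !scalerA.
  rewrite invfM mulrA mulfV // mul1r mulVf ?gt_eqF //.
  by rewrite scale1r.
exists p, q; split.
- apply: (scalerI two); rewrite scalerBr ep eq /f /f' scaler_nat; ring.
- move: f0; rewrite -ep hornerZ horner_exp; apply: contraTneq => ->.
  by rewrite expr0n mulr0 ltxx.
- have [sf _] := sizef; move: sf; rewrite -ep (size_scale _ two).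
  by rewrite size_sqr_poly => sp; clear -sp; lia.
- have [->|q0] := eqVneq q 0; first by rewrite size_poly0.
  have [_ sf'] := sizef; move: sf'; rewrite -eq (size_scale _ two).
  by rewrite size_sqr_cubic // => sq; clear -sq; lia.
Qed.

End PeriodicToPell.

(** * Billiard trajectories *)

Section Trajectories.
Variables (R : realType) (a b : R).
Hypotheses (hb : 0 < b) (hab : b < a).
Implicit Types (c t : R) (x v N : 'rV[R]_2) (W : 'M[{poly R}]_2).
Implicit Types xs vs : nat -> 'rV[R]_2.

Let ha : 0 < a. Proof. exact: lt_trans hb hab. Qed.

Definition ellipse_form x v : R := x 0 0 * v 0 0 / a + x 0 1 * v 0 1 / b.

Lemma ellipse_formDr x v t :
  ellipse_form (x + t *: v) (x + t *: v) =
  ellipse_form x x + 2 * t * ellipse_form x v + t ^+ 2 * ellipse_form v v.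
Proof. by rewrite /ellipse_form !mxE; ring. Qed.

Lemma on_ellipseE x : on_ellipse a b x <-> ellipse_form x x = 1.
Proof. by rewrite /on_ellipse /ellipse_form !expr2. Qed.

Lemma in_domainE x : in_domain a b x <-> ellipse_form x x <= 1.
Proof. by rewrite /in_domain /ellipse_form !expr2. Qed.

Lemma ellipse_form_gt0 v : dot v v = 1 -> 0 < ellipse_form v v.
Proof.
move=> hv; rewrite /ellipse_form -!expr2.
have h0 := sqr_ge0 (v 0 0); have h1 := sqr_ge0 (v 0 1).
move: hv; rewrite dotE -!expr2 => hv.
have a'0 : 0 < a^-1 by rewrite invr_gt0.
have b'0 : 0 < b^-1 by rewrite invr_gt0.
have : a^-1 <= b^-1 by rewrite lef_pV2 ?posrE // ltW.
by nra.
Qed.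

(** A hit with its divisions removed: [N] is the normal at the hit point, [v - c N] the reflected
    velocity, and the half-turn changes the signs. *)
Record bounce t c N x v x' v' : Prop := Bounce {
  bounce_t : 0 < t;
  bounce_c : 0 < c;
  bounce_x : x' = - (x + t *: v);
  bounce_v : v' = c *: N - v;
  bounce_N0 : (x + t *: v) 0 0 = a * N 0 0;
  bounce_N1 : (x + t *: v) 0 1 = b * N 0 1;
  bounce_N : a * N 0 0 ^+ 2 + b * N 0 1 ^+ 2 = 1;
  bounce_cN : c * dot N N = 2 * dot v N }.

Lemma dot_gt0 N : a * N 0 0 ^+ 2 + b * N 0 1 ^+ 2 = 1 -> 0 < dot N N.
Proof.
rewrite dotE => hN.
have h0 := sqr_ge0 (N 0 0); have h1 := sqr_ge0 (N 0 1).
rewrite -!expr2 lt_neqAle addr_ge0 // andbT eq_sym paddr_eq0 //.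
apply/negP => /andP[/eqP e0 /eqP e1].
by move: hN; rewrite e0 e1 !mulr0 addr0 => /eqP; rewrite eq_sym oner_eq0.
Qed.

(** The particle is outgoing at the hit point [A]: as [x = A - t v] is in the domain, expanding the
    quadratic form at [A] gives [t Q <= 2 D] with [Q > 0] and [D = dot v N]. *)
Lemma bounce_of_hit t x v x' v' :
    in_domain a b x -> dot v v = 1 -> 0 < t ->
    on_ellipse a b (x + t *: v) -> x' = half_turn (x + t *: v) ->
    v' = half_turn (reflect_at a b (x + t *: v) v) ->
  exists c N, bounce t c N x v x' v'.
Proof.
set A := x + t *: v; set N := ellipse_normal a b A => hx hv ht hA ex ev.
have N0 : A 0 0 = a * N 0 0 by rewrite [N 0 _]mxE /= mulrC divfK ?gt_eqF.
have N1 : A 0 1 = b * N 0 1 by rewrite [N 0 _]mxE /= mulrC divfK ?gt_eqF.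
have hN : a * N 0 0 ^+ 2 + b * N 0 1 ^+ 2 = 1.
  by rewrite -hA N0 N1; field; rewrite !gt_eqF.
have NN := dot_gt0 hN.
have vN : 0 < dot v N.
  have -> : dot v N = ellipse_form A v.
    by rewrite /ellipse_form N0 N1 dotE; field; rewrite !gt_eqF.
  have ex' : x = A + (- t) *: v by rewrite scaleNr addrK.
  have := ellipse_form_gt0 hv; move: hx; rewrite in_domainE ex' ellipse_formDr.
  rewrite (_ : ellipse_form A A = 1); last exact/on_ellipseE.
  set D := ellipse_form A v; set Q := ellipse_form v v => h1 v_gt0.
  have : t * (t * Q) <= t * (2 * D) by nra.
  by rewrite ler_pM2l // => h2; have := mulr_gt0 ht v_gt0; nra.
exists (2 * dot v N / dot N N), N; split => //.
- by rewrite divr_gt0 ?mulr_gt0.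
- by rewrite ev /reflect_at /half_turn opprB.
- by rewrite divfK ?gt_eqF.
Qed.

Lemma bounce_unit t c N x v x' v' :
  bounce t c N x v x' v' -> dot v v = 1 -> dot v' v' = 1.
Proof.
case=> _ _ _ -> _ _ _; rewrite !dotE !mxE => hc hv.
transitivity (v 0 0 * v 0 0 + v 0 1 * v 0 1 +
  c * (c * (N 0 0 * N 0 0 + N 0 1 * N 0 1) -
    2 * (v 0 0 * N 0 0 + v 0 1 * N 0 1))); first by ring.
by rewrite hc hv subrr mulr0 addr0.
Qed.

Lemma bounce_ellipse t c N x v x' v' :
  bounce t c N x v x' v' -> on_ellipse a b x'.
Proof.
case=> _ _ -> _ N0 N1 hN _; rewrite /on_ellipse !mxE.
rewrite !mxE in N0 N1; rewrite N0 N1 -hN.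
by field; rewrite !gt_eqF.
Qed.

(* Joachimsthal's integral: the level of the caustic is [a b (v . N)^2]. *)
Lemma caustic_level_normal x v N :
    x 0 0 = a * N 0 0 -> x 0 1 = b * N 0 1 ->
    a * N 0 0 ^+ 2 + b * N 0 1 ^+ 2 = 1 ->
  caustic_level a b x v = a * b * dot v N ^+ 2.
Proof.
move=> x0 x1 hN; rewrite /caustic_level dotE x0 x1.
apply/eqP; rewrite -subr_eq0; apply/eqP.
transitivity ((b * v 0 0 ^+ 2 + a * v 0 1 ^+ 2) *
  (1 - (a * N 0 0 ^+ 2 + b * N 0 1 ^+ 2))); first by ring.
by rewrite hN subrr mulr0.
Qed.

Lemma caustic_level_shear t x v :
  caustic_level a b (x + t *: v) v = caustic_level a b x v.
Proof. by rewrite /caustic_level !mxE; ring. Qed.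

(** By Joachimsthal's integral, since the normal component only changes sign. *)
Lemma bounce_caustic t c N x v x' v' :
  bounce t c N x v x' v' -> caustic_level a b x' v' = caustic_level a b x v.
Proof.
case=> _ _ -> -> N0 N1 hN hc.
rewrite -[RHS](caustic_level_shear t) (caustic_level_normal v N0 N1 hN).
rewrite (@caustic_level_normal _ _ (- N)); last 3 first.
- by rewrite [LHS]mxE [in RHS]mxE N0 mulrN.
- by rewrite [LHS]mxE [in RHS]mxE N1 mulrN.
- by rewrite !mxE !sqrrN.
congr (_ * _).
move: hc; rewrite !dotE !mxE => hc.
apply/eqP; rewrite -subr_eq0; apply/eqP.
transitivity ((2 * (v 0 0 * N 0 0 + v 0 1 * N 0 1) -
  c * (N 0 0 * N 0 0 + N 0 1 * N 0 1)) *
  - (c * (N 0 0 * N 0 0 + N 0 1 * N 0 1))); first by ring.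
by rewrite hc subrr mul0r.
Qed.

Definition step t c : 'M[{poly R}]_2 := kick c *m shear t.

Lemma stepE t c :
  step t c = mx2 (- 'X) (- ('X * t%:P)) c%:P ((c * t)%:P - 'X).
Proof. by rewrite /step /kick /shear mul_mx2; congr mx2; ring. Qed.

Lemma det2_step t c : det2 (step t c) = 'X^2.
Proof. by rewrite stepE det2E; ring. Qed.

(** The discrete Lax equation: the shear is the free flight, the kick the reflection with the
    half-turn. *)
Lemma step_lax t c N x v x' v' : bounce t c N x v x' v' ->
  step t c *m lax a b x v = lax a b x' v' *m step t c.
Proof.
case=> _ _ -> -> N0 N1 hN hc.
by rewrite /step -mulmxA lax_shear mulmxA (lax_kick N0 N1 hN hc) mulmxA.
Qed.

(* At [l = a] (resp. [l = b]) the Lax matrix is a rank one nilpotent matrix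
   built on the first (resp. second) coordinates of [x] and [v]; this is what
   tells apart the trajectories symmetric to each other. *)
Record monodromy k x v x' v' W : Prop := Monodromy {
  mono_det : det2 W = 'X^(2 * k);
  mono_lax : W *m lax a b x v = lax a b x' v' *m W;
  mono_ax : (W 0 0).[a] * x 0 0 + (W 0 1).[a] * v 0 0 = a ^+ k * x' 0 0;
  mono_av : (W 1 0).[a] * x 0 0 + (W 1 1).[a] * v 0 0 = a ^+ k * v' 0 0;
  mono_bx : (W 0 0).[b] * x 0 1 + (W 0 1).[b] * v 0 1 = b ^+ k * x' 0 1;
  mono_bv : (W 1 0).[b] * x 0 1 + (W 1 1).[b] * v 0 1 = b ^+ k * v' 0 1;
  mono_size : forall i j m, (k < m)%N -> (W i j)`_m = 0;
  mono_lead : [/\ (W 0 0)`_k = (-1) ^+ k, (W 1 0)`_k = 0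
                & (W 1 1)`_k = (-1) ^+ k];
  mono_at0 : [/\ 0 <= (W 0 0).[0], 0 <= (W 0 1).[0], 0 <= (W 1 0).[0]
               & 0 < (W 1 1).[0]] }.

Lemma monodromy0 x v : monodromy 0 x v x v 1%:M.
Proof.
split.
- by rewrite scalar_mx2 det2E; ring.
- by rewrite mul1mx mulmx1.
all: rewrite scalar_mx2.
1-4: by rewrite !mxE /= !hornerE; ring.
- move=> i j [//|m] _; rewrite mxE.
  by do 2 case: ifP => _; rewrite ?coef0 ?coef1.
- by rewrite !mxE /= coef0 !coef1 expr0.
- by rewrite !mxE /= !hornerE.
Qed.

(** The leading coefficient of a step in [l] is minus a unipotent upper triangular matrix, and its
    value at [l = 0] has the rows [(0, 0)] and [(c, c t)]; hence the last two fields propagate. *)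
Lemma monodromyS k t c N x0 v0 x v x' v' W :
    bounce t c N x v x' v' -> monodromy k x0 v0 x v W ->
  monodromy k.+1 x0 v0 x' v' (step t c *m W).
Proof.
move=> B [hdet hlax hax hav hbx hbv hsize [h00 h10 h11] [p00 p01 p10 p11]].
have L := step_lax B.
have [ht hc ex ev N0 N1 _ _] := B.
split.
- by rewrite det2M hdet det2_step mulnS exprD.
- by rewrite -mulmxA hlax mulmxA L mulmxA.
all: rewrite stepE [W]mx2_eta mul_mx2.
all: try rewrite !mxE /= !hornerE.
- rewrite ex !mxE exprS; rewrite !mxE in N0.
  transitivity (- a * ((W 0 0).[a] * x0 0 0 + (W 0 1).[a] * v0 0 0)
    - a * t * ((W 1 0).[a] * x0 0 0 + (W 1 1).[a] * v0 0 0)); first by ring.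
  by rewrite hax hav; ring.
- rewrite ev !mxE exprS; rewrite !mxE in N0.
  transitivity (c * ((W 0 0).[a] * x0 0 0 + (W 0 1).[a] * v0 0 0)
    + (c * t - a) * ((W 1 0).[a] * x0 0 0 + (W 1 1).[a] * v0 0 0)).
    by ring.
  have -> : a * a ^+ k * (c * N 0 0 - v 0 0) =
    a ^+ k * (c * (a * N 0 0) - a * v 0 0) by ring.
  by rewrite hax hav -N0; ring.
- rewrite ex !mxE exprS; rewrite !mxE in N1.
  transitivity (- b * ((W 0 0).[b] * x0 0 1 + (W 0 1).[b] * v0 0 1)
    - b * t * ((W 1 0).[b] * x0 0 1 + (W 1 1).[b] * v0 0 1)); first by ring.
  by rewrite hbx hbv; ring.
- rewrite ev !mxE exprS; rewrite !mxE in N1.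
  transitivity (c * ((W 0 0).[b] * x0 0 1 + (W 0 1).[b] * v0 0 1)
    + (c * t - b) * ((W 1 0).[b] * x0 0 1 + (W 1 1).[b] * v0 0 1)).
    by ring.
  have -> : b * b ^+ k * (c * N 0 1 - v 0 1) =
    b ^+ k * (c * (b * N 0 1) - b * v 0 1) by ring.
  by rewrite hbx hbv -N1; ring.
- move=> i j [//|m]; rewrite ltnS => km.
  have km' : (k < m.+1)%N by rewrite ltnS ltnW.
  rewrite mxE; do 2 case: ifP => _; rewrite ?mulNr ?mulrBl -?mulrA;
    rewrite !(coefD, coefB, coefN, coefXM, coefCM) /= !hsize //; ring.
- rewrite !mxE /= ?mulNr ?mulrBl -?mulrA.
  rewrite !(coefD, coefB, coefN, coefXM, coefCM) /= h00 h10 h11 !hsize //.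
  by rewrite exprS; split; ring.
- have ct := mulr_gt0 hc ht; rewrite oppr0 !mul0r !addr0.
  split=> //; first by rewrite addr_ge0 // mulr_ge0 // ltW.
  by rewrite ltr_wpDl ?mulr_gt0 // mulr_ge0 // ltW.
Qed.

Lemma magic_invariant xs vs k : magic_trajectory a b xs vs ->
  in_domain a b (xs k) /\ dot (vs k) (vs k) = 1.
Proof.
case=> hx hv hstep; elim: k => [//|k [dk uk]].
have [t ht [hA ex ev]] := hstep k.
have [c [N B]] := bounce_of_hit dk uk ht hA ex ev.
split; last exact: bounce_unit B uk.
by have := bounce_ellipse B; rewrite /on_ellipse /in_domain => ->.
Qed.

Lemma magic_bounce xs vs k : magic_trajectory a b xs vs ->
  exists t c N, bounce t c N (xs k) (vs k) (xs k.+1) (vs k.+1).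
Proof.
move=> T; have [dk uk] := magic_invariant k T.
have [_ _ hstep] := T; have [t ht [hA ex ev]] := hstep k.
by exists t; exact: bounce_of_hit.
Qed.

Lemma magic_caustic_level xs vs k : magic_trajectory a b xs vs ->
  caustic_level a b (xs k) (vs k) = caustic_level a b (xs 0) (vs 0).
Proof.
move=> T; elim: k => [//|k <-].
by have [t [c [N B]]] := magic_bounce k T; exact: bounce_caustic B.
Qed.

Lemma magic_monodromy xs vs k : magic_trajectory a b xs vs ->
  exists W, monodromy k (xs 0) (vs 0) (xs k) (vs k) W.
Proof.
move=> T; elim: k => [|k [W HW]]; first by exists 1%:M; exact: monodromy0.
have [t [c [N B]]] := magic_bounce k T.
by exists (step t c *m W); exact: monodromyS B HW.
Qed.

(** The shear by [t] moves the base point of the last line back to [xs 0], so that [shear t *m W]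
    commutes with the initial Lax matrix; [t >= 0] preserves the signs at [l = 0]. *)
Lemma periodic_pell beta n xs vs : 0 < beta -> beta < a -> (0 < n)%N ->
    magic_trajectory a b xs vs ->
    xs 0 0 0 = 0 -> xs 0 0 1 != 0 -> vs 0 0 0 != 0 -> vs 0 0 1 != 0 ->
    caustic_level a b (xs 0) (vs 0) = beta ->
    n_periodic n xs vs ->
  exists p q, pell_pair a b beta n p q.
Proof.
move=> b0 ba n0 T x0 x1 v0 v1 hl [ev [t t0 ex]].
have [W [hdet hlax _ hav _ hbv hsize _ [p00 p01 p10 p11]]] :=
  magic_monodromy n T.
have [_ uv] := magic_invariant 0 T.
have SW i j : (shear t *m W) i j = W i j + (if i == 0 then t%:P * W 1 j else 0).
  by rewrite /shear [W]mx2_eta mul_mx2 !mxE; do 2 case: ifP => _ /=; ring.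
apply: (@pell_of_commutant _ a b beta hb hab b0 ba n (xs 0) (vs 0)
  (shear t *m W)) => //.
- by rewrite det2M hdet /shear det2E; ring.
- by rewrite -mulmxA hlax mulmxA lax_shear -ex ev mulmxA.
- by rewrite !SW /= !addr0 hav ev.
- by rewrite !SW /= !addr0 hbv ev.
- move=> i j m nm; rewrite SW coefD hsize // add0r.
  by case: ifP => _; rewrite ?coef0 // coefCM hsize // mulr0.
- rewrite !SW /= addr0 !(hornerD, hornerM, hornerC).
  by rewrite ltr_wpDl // addr_ge0 // mulr_ge0.
Qed.

(* For [x] on the ellipse, the nonzero time at which [x + t v] is on it. *)
Definition exit_time x v : R := - 2 * ellipse_form x v / ellipse_form v v.

Definition magic_map (s : 'rV[R]_2 * 'rV[R]_2) : 'rV[R]_2 * 'rV[R]_2 :=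
  let A := s.1 + exit_time s.1 s.2 *: s.2 in
  (half_turn A, half_turn (reflect_at a b A s.2)).

(** The form equals [dot v N - c * dot N N], which is [- c * dot N N / 2]. *)
Lemma bounce_inward t c N x v x' v' :
  bounce t c N x v x' v' -> ellipse_form x' v' < 0.
Proof.
move=> [_ hc -> -> N0 N1 hN hcN].
have NN := dot_gt0 hN.
have -> : ellipse_form (- (x + t *: v)) (c *: N - v) = - (c * dot N N) / 2.
  have y0 : (- (x + t *: v)) 0 0 = - (a * N 0 0) by rewrite mxE N0.
  have y1 : (- (x + t *: v)) 0 1 = - (b * N 0 1) by rewrite mxE N1.
  rewrite /ellipse_form y0 y1.
  transitivity (dot v N - c * dot N N); last by rewrite hcN; field.
  by rewrite !dotE !mxE; field; rewrite !gt_eqF.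
by rewrite mulNr oppr_lt0 divr_gt0 // mulr_gt0.
Qed.

(** For [t < 0] both terms added to [ellipse_form x x = 1] would be nonnegative, and one positive.
    This settles the sign of the return time in [n_periodic]. *)
Lemma inward_chord x v t :
    on_ellipse a b x -> ellipse_form x v < 0 -> dot v v = 1 ->
    in_domain a b (x + t *: v) ->
  0 <= t.
Proof.
rewrite on_ellipseE in_domainE => hx hxv /ellipse_form_gt0 hv.
rewrite ellipse_formDr hx => h; rewrite leNgt; apply/negP => t0.
have : 0 < t * ellipse_form x v by rewrite nmulr_rgt0.
have := sqr_ge0 t; nra.
Qed.

(** Each bounce restores a point of the ellipse with an inward velocity, for which the exit time is
    positive. *)
Lemma inward_trajectory x v :
    on_ellipse a b x -> dot v v = 1 -> ellipse_form x v < 0 ->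
  exists2 s : nat -> 'rV[R]_2 * 'rV[R]_2, s 0 = (x, v)
    & magic_trajectory a b (fst \o s) (snd \o s).
Proof.
move=> hx hv hxv; pose s k := iter k magic_map (x, v).
exists s => //.
have inv k : [/\ on_ellipse a b (s k).1, dot (s k).2 (s k).2 = 1,
    ellipse_form (s k).1 (s k).2 < 0 &
    let A := (s k).1 + exit_time (s k).1 (s k).2 *: (s k).2 in
    0 < exit_time (s k).1 (s k).2 /\ on_ellipse a b A].
  have hit y u : on_ellipse a b y -> dot u u = 1 -> ellipse_form y u < 0 ->
      let A := y + exit_time y u *: u in
      0 < exit_time y u /\ on_ellipse a b A.
    move=> /on_ellipseE hy /ellipse_form_gt0 hu hyu /=; split.
      by rewrite /exit_time divr_gt0 // mulNr -mulrN mulr_gt0 // oppr_gt0.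
    rewrite on_ellipseE ellipse_formDr hy /exit_time; field.
    by rewrite gt_eqF.
  elim: k => [|k [ey uk hin [ht hA]]]; first by split=> //; exact: hit.
  have dk : in_domain a b (s k).1 by rewrite /in_domain ey.
  have [c [N B]] := bounce_of_hit dk uk ht hA erefl erefl.
  have ey' := bounce_ellipse B.
  have uk' := bounce_unit B uk.
  have hin' := bounce_inward B.
  by split=> //; exact: hit.
split=> [||k].
- by have [hx0 _ _ _] := inv 0%N; move: hx0; rewrite /in_domain => ->.
- by have [] := inv 0%N.
- have [_ _ _ [ht hA]] := inv k.
  by exists (exit_time (s k).1 (s k).2).
Qed.

(** At the vertex [(0, sqrt b)] the caustic level of a unit velocity [v] is [a v_2^2], which
    dictates [v_2^2 = beta / a]. *)
Lemma vertex_trajectory beta : 0 < beta -> beta < a ->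
  exists xs vs, [/\ magic_trajectory a b xs vs,
    caustic_level a b (xs 0) (vs 0) = beta,
    xs 0 0 0 = 0, xs 0 0 1 != 0 & vs 0 0 0 != 0 /\ vs 0 0 1 != 0].
Proof.
move=> b0 ba.
pose x : 'rV[R]_2 := \row_i if i == 0 then 0 else Num.sqrt b.
pose v : 'rV[R]_2 := \row_i if i == 0 then Num.sqrt ((a - beta) / a)
                            else - Num.sqrt (beta / a).
have v0_gt0 : 0 < (a - beta) / a by rewrite divr_gt0 // subr_gt0.
have v1_gt0 : 0 < beta / a by rewrite divr_gt0.
have x0 : x 0 0 = 0 by rewrite mxE.
have x1 : x 0 1 = Num.sqrt b by rewrite mxE.
have v0 : v 0 0 = Num.sqrt ((a - beta) / a) by rewrite mxE.
have v1 : v 0 1 = - Num.sqrt (beta / a) by rewrite mxE.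
have sx1 : x 0 1 ^+ 2 = b by rewrite x1 sqr_sqrtr // ltW.
have sv0 : v 0 0 ^+ 2 = (a - beta) / a by rewrite v0 sqr_sqrtr // ltW.
have sv1 : v 0 1 ^+ 2 = beta / a by rewrite v1 sqrrN sqr_sqrtr // ltW.
have hx : on_ellipse a b x.
  by rewrite /on_ellipse x0 sx1 expr0n mul0r add0r divff ?gt_eqF.
have hv : dot v v = 1.
  by rewrite dotE -!expr2 sv0 sv1; field; rewrite gt_eqF.
have hxv : ellipse_form x v < 0.
  rewrite /ellipse_form x0 !mul0r add0r x1 v1 mulrN mulNr oppr_lt0.
  by rewrite divr_gt0 // mulr_gt0 // sqrtr_gt0.
have [s s0 T] := inward_trajectory hx hv hxv.
exists (fst \o s), (snd \o s); rewrite /= s0 /=; split=> //.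
- rewrite /caustic_level x0 mul0r sub0r sqrrN exprMn sx1 sv0 sv1.
  by field; rewrite gt_eqF.
- by rewrite x1 gt_eqF // sqrtr_gt0.
- by rewrite v0 v1 oppr_eq0 !gt_eqF // sqrtr_gt0.
Qed.

End Trajectories.

(** * From the Pell equation to periodicity *)

Section PolynomialMatrices.
Variable F : fieldType.
Implicit Types (p q d e : {poly F}) (M N : 'M[{poly F}]_2).

Definition mxdvd d M := forall i j, d %| M i j.

Lemma mxdvdM d e M N : mxdvd d M -> mxdvd e N -> mxdvd (d * e) (M *m N).
Proof.
move=> dM eN i j; rewrite mxE; apply: (big_ind (fun p => d * e %| p)) => //.
- by move=> p q; exact: dvdp_add.
- by move=> k _; exact: dvdp_mul.
Qed.

Lemma mxdvd_mull d M N : mxdvd d N -> mxdvd d (M *m N).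
Proof.
move=> dN; rewrite -[d]mul1r; apply: mxdvdM => // i j; exact: dvd1p.
Qed.

Lemma mxdvdP d M : d != 0 -> mxdvd d M -> exists N, M = d *: N.
Proof.
move=> d0 dM; exists (\matrix_(i, j) (M i j %/ d)).
by apply/matrixP => i j; rewrite !mxE mulrC divpK.
Qed.

Lemma coefM_top p q m k : (size p <= m.+1)%N -> (size q <= k.+1)%N ->
  (p * q)`_(m + k) = p`_m * q`_k.
Proof.
move=> /leq_sizeP sp /leq_sizeP sq; rewrite coefM.
have mk : (m < (m + k).+1)%N by rewrite ltnS leq_addr.
rewrite (bigD1 (Ordinal mk)) //= addKn big1 ?addr0 // => i.
rewrite -val_eqE /= neq_ltn => /orP[im|mi]; last by rewrite sp ?mul0r.
by rewrite sq ?mulr0 //; lia.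
Qed.

End PolynomialMatrices.

(** * Right divisibility of [P + Q L] by the bounces *)

Section PellToPeriodic.
Variables (R : realType) (a b beta : R).
Hypotheses (hb : 0 < b) (hab : b < a) (h0beta : 0 < beta).

Let ha : 0 < a. Proof. exact: lt_trans hb hab. Qed.
Notation C := (confocal_cubic a b beta).

Section PellStep.
Variables (P Q : {poly R}) (n : nat).
Hypotheses (n0 : (0 < n)%N) (PQ : P ^+ 2 - Q ^+ 2 * C = 'X^(2 * n)).
Hypotheses (P0 : P.[0] != 0).
Hypothesis PQ0 : P.[0] + Q.[0] * Num.sqrt (a * b * beta) = 0.

(** At [l = 0], for a line of caustic [beta] about to hit the ellipse, it has rank one, and the sign
    in [PQ0] gives it the same kernel as the next step. *)
Definition pell_mx (x v : 'rV[R]_2) : 'M[{poly R}]_2 :=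
  P%:M + Q *: lax a b x v.

Lemma pell_mxE x v : pell_mx x v =
  mx2 (P - Q * confocal_form a b x v)
      (Q * (confocal_form a b x x - (a%:P - 'X) * (b%:P - 'X)))
      (- (Q * confocal_form a b v v)) (P + Q * confocal_form a b x v).
Proof. by rewrite /pell_mx /lax !mx2E; congr mx2; ring. Qed.

Lemma det2_pell_mx x v : dot v v = 1 -> caustic_level a b x v = beta ->
  det2 (pell_mx x v) = 'X^(2 * n).
Proof.
move=> hv hl; have := det2_lax a b x hv; rewrite hl /lax det2E => eC.
rewrite pell_mxE det2E -PQ.
transitivity (P ^+ 2 + Q ^+ 2 * (- C)); first by rewrite -eC; ring.
by ring.
Qed.

Lemma adj2_step t c : adj2 (step t c) =
  mx2 1 (- t%:P) 0 1 *m mx2 (- 'X) 0 (- c%:P) (- 'X) :> 'M[{poly R}]_2.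
Proof. by rewrite stepE adj2E mul_mx2; congr mx2; ring. Qed.

Lemma shear_pell_mx t x v :
  pell_mx x v *m mx2 1 (- t%:P) 0 1 =
  mx2 1 (- t%:P) 0 1 *m pell_mx (x + t *: v) v.
Proof.
by rewrite !pell_mxE !mul_mx2 /confocal_form !mxE; congr mx2; ring.
Qed.

Lemma dvdXn2 (p : {poly R}) : p.[0] = 0 -> 'X^2 %| 'X * p.
Proof.
move=> p0; rewrite expr2 dvdp_mul //.
by rewrite -['X]subr0 -polyC0 dvdp_XsubCl /root p0.
Qed.

(** As [adj2 (step t c)] is [l^2] times the inverse of the step, this is divisibility by the step on
    the right. The base point is first moved to the hit point, where the upper right Lax entry is
    divisible by [l]. *)
Lemma pell_step t c (N x v x' v' : 'rV[R]_2) : bounce a b t c N x v x' v' ->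
    dot v v = 1 -> caustic_level a b x v = beta ->
  mxdvd 'X^2 (pell_mx x v *m adj2 (step t c)).
Proof.
case=> ht hc _ _ N0 N1 hN hcN hv hl.
rewrite adj2_step mulmxA shear_pell_mx -mulmxA; apply: mxdvd_mull.
set y := x + t *: v in N0 N1 *.
have hly : caustic_level a b y v = beta by rewrite caustic_level_shear.
have := det2_pell_mx hv hly; rewrite pell_mxE det2E mul_mx2.
set g := confocal_form a b y v.
pose h := (a * N 0 0 ^+ 2)%:P * (b%:P - 'X) + (b * N 0 1 ^+ 2)%:P * (a%:P - 'X).
have -> : confocal_form a b y y - (a%:P - 'X) * (b%:P - 'X) = 'X * h.
  have /(congr1 polyC) := hN; rewrite polyC1 => hN1.
  rewrite -[_ * (_ - _) in LHS]mul1r -hN1 /confocal_form N0 N1 /h; ring.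
set k := confocal_form a b v v => hdet.
have vN : 0 < dot v N.
  by rewrite -(pmulr_rgt0 _ (_ : 0 < 2)) // -hcN mulr_gt0 // (dot_gt0 hN).
(* Joachimsthal's integral gives the square; the root is positive because the particle is
   outgoing. *)
have g0 : g.[0] = Num.sqrt (a * b * beta).
  have -> : g.[0] = a * b * dot v N.
    by rewrite /g horner_confocal_form N0 N1 dotE; ring.
  rewrite -hly (caustic_level_normal v N0 N1 hN).
  have -> : a * b * (a * b * dot v N ^+ 2) = (a * b * dot v N) ^+ 2 by ring.
  by rewrite sqrtr_sqr ger0_norm // !mulr_ge0 // ltW.
have h0 : c * h.[0] = 2 * g.[0].
  have -> : h.[0] = a * b * dot N N.
    by rewrite /h hornerD !hornerM !hornerD !hornerN !hornerC hornerX dotE;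
      ring.
  have -> : g.[0] = a * b * dot v N.
    by rewrite /g horner_confocal_form N0 N1 dotE; ring.
  by rewrite mulrCA hcN; ring.
clearbody g h k.
have r1 : (P + Q * g).[0] = 0 by rewrite hornerD hornerM g0.
have r2 : (P - Q * g + c%:P * (Q * h)).[0] = 0.
  rewrite !(hornerD, hornerN, hornerM, hornerC) [c * _]mulrCA h0.
  by rewrite -[RHS]PQ0 -g0; ring.
have d1 : 'X^2 %| 'X * (P - Q * g) + c%:P * (Q * ('X * h)).
  have -> : 'X * (P - Q * g) + c%:P * (Q * ('X * h)) =
    'X * (P - Q * g + c%:P * (Q * h)) by ring.
  exact: dvdXn2.
(* The determinant vanishes modulo [l^2] and [P - Q g] is invertible there, so the second row
   follows from the first. *)
have d2 : 'X^2 %| 'X * - (Q * k) + c%:P * (P + Q * g).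
  have cop : coprimep 'X^2 (P - Q * g).
    rewrite coprimep_expl // coprimep_sym coprimepX /root.
    have -> : (P - Q * g).[0] = 2 * P.[0].
      rewrite !(hornerD, hornerN, hornerM) g0.
      transitivity (2 * P.[0] - (P.[0] + Q.[0] * Num.sqrt (a * b * beta)));
        by [ring | rewrite PQ0 subr0].
    by rewrite mulf_neq0 // pnatr_eq0.
  rewrite -(Gauss_dvdpr _ cop).
  have -> : (P - Q * g) * ('X * - (Q * k) + c%:P * (P + Q * g)) =
    - (Q * k) * ('X * (P - Q * g) + c%:P * (Q * ('X * h))) +
    c%:P * ((P - Q * g) * (P + Q * g) - Q * ('X * h) * - (Q * k)) by ring.
  rewrite hdet dvdp_add ?dvdp_mull //.
  by rewrite dvdp_exp2l // -{1}[2%N]muln1 leq_pmul2l.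
move=> i j; rewrite mxE; do 2 case: ifP => _.
- rewrite -dvdpNr; apply: etrans d1; congr (_ %| _); ring.
- rewrite -dvdpNr; have -> : - ((P - Q * g) * 0 + Q * ('X * h) * - 'X) =
    'X^2 * (Q * h) by ring.
  exact: dvdp_mulr.
- rewrite -dvdpNr; apply: etrans d2; congr (_ %| _); ring.
- rewrite -dvdpNr; have -> : - (- (Q * k) * 0 + (P + Q * g) * - 'X) =
    'X * (P + Q * g) by ring.
  exact: dvdXn2.
Qed.

(* [pell_mx (xs 0) (vs 0)] squares to [2 P] times itself modulo ['X^(2 n)], so
   it may be used once per bounce without losing divisibility. *)
Lemma pell_monodromy xs vs k : magic_trajectory a b xs vs ->
    caustic_level a b (xs 0) (vs 0) = beta -> (k <= n)%N ->
  exists2 W, monodromy a b k (xs 0) (vs 0) (xs k) (vs k) W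
    & mxdvd 'X^(2 * k) (pell_mx (xs 0) (vs 0) *m adj2 W).
Proof.
move=> T hl; elim: k => [_|k IH kn].
  exists 1%:M; first exact: monodromy0.
  by move=> i j; rewrite muln0 expr0 dvd1p.
have [W HW dW] := IH (ltnW kn).
have [t [c [N B]]] := magic_bounce hb hab k T.
exists (step t c *m W); first exact: monodromyS B HW.
have [_ uk] := magic_invariant hb hab k T.
have [_ u0] := magic_invariant hb hab 0 T.
have lk : caustic_level a b (xs k) (vs k) = beta.
  by rewrite (magic_caustic_level hb hab k T).
have dS := pell_step B uk lk.
have [hdet hlax _ _ _ _ _ _ _] := HW.
set M0 := pell_mx (xs 0) (vs 0) in dW *; set Mk := pell_mx (xs k) (vs k) in dS.
(* [W] intertwines [M0] and [Mk], as it does the Lax matrices; its adjugate does so in the opposite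
   direction, after cancelling [l^(2 k)]. *)
have WM : M0 *m adj2 W = adj2 W *m Mk.
  have WM' : W *m M0 = Mk *m W.
    rewrite /M0 /Mk /pell_mx mulmxDr mulmxDl -scalemxAr hlax -scalemxAl.
    by rewrite mul_mx_scalar mul_scalar_mx.
  have X0 : 'X^(2 * k) != 0 :> {poly R} by rewrite expf_neq0 ?polyX_eq0.
  have : adj2 W *m (W *m M0) *m adj2 W = adj2 W *m (Mk *m W) *m adj2 W.
    by rewrite WM'.
  rewrite mulmxA mul_adj2_mx hdet -!mulmxA mul_mx2_adj hdet.
  rewrite mul_mx_scalar mul_scalar_mx -scalemxAr => /matrixP E.
  apply/matrixP => i j; apply: (mulfI X0).
  by move: (E i j); rewrite [LHS]mxE [RHS]mxE.
have M2 : M0 *m (M0 *m adj2 (step t c *m W)) =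
    (2%:P * P) *: (M0 *m adj2 (step t c *m W)) -
    'X^(2 * n) *: adj2 (step t c *m W).
  rewrite mulmxA mx2_sqr det2_pell_mx // mulmxBl -scalemxAl mul_scalar_mx.
  congr (_ *: _ - _); rewrite /M0 pell_mxE !mxE /=; ring.
(* One [M0] pairs with [adj2 W]; the other becomes [Mk] on passing [adj2 W] and pairs with the
   adjugate of the new step. *)
have d2 : mxdvd 'X^(2 * k.+1) (M0 *m (M0 *m adj2 (step t c *m W))).
  rewrite adj2M [M0 *m (adj2 W *m _)]mulmxA WM -mulmxA mulmxA.
  by rewrite mulnS addnC exprD; apply: mxdvdM.
move=> i j; have := d2 i j; rewrite M2 mxE [X in _ + X]mxE [X in X - _]mxE.
rewrite dvdp_subl; last first.
  by rewrite mxE dvdp_mulr // dvdp_exp2l // leq_mul2l kn.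
rewrite Gauss_dvdpr // coprimep_expl // coprimep_sym coprimepX /root.
by rewrite hornerM hornerC mulf_neq0 // pnatr_eq0.
Qed.

End PellStep.

(** At [l = 0] the equation gives [p^2 = q^2 a b beta]; the sign of [q] is free. *)
Lemma pell_pair_sign n p q : (0 < n)%N -> pell_pair a b beta n p q ->
  exists2 r, pell_pair a b beta n p r
    & p.[0] = - (r.[0] * Num.sqrt (a * b * beta)).
Proof.
move=> n0 [E p0 sp sq]; set w := Num.sqrt _.
have w2 : w ^+ 2 = a * b * beta by rewrite sqr_sqrtr // !mulr_ge0 // ltW.
have : (p.[0] - q.[0] * w) * (p.[0] + q.[0] * w) = 0.
  have /(congr1 (horner^~ 0)) := E.
  rewrite /confocal_cubic hornerD hornerN !hornerM !horner_exp hornerX expr0n.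
  rewrite -[n == 0%N]negbK -lt0n n0 !hornerD !hornerN !hornerC hornerX /= => E0.
  apply: etrans E0; transitivity (p.[0] ^+ 2 - q.[0] ^+ 2 * w ^+ 2).
    by ring.
  by rewrite w2; ring.
move=> /eqP; rewrite mulf_eq0 => /orP[/eqP h|/eqP h].
- exists (- q); first by split; rewrite ?sqrrN ?size_polyN.
  by rewrite hornerN mulNr opprK; apply/eqP; rewrite -subr_eq0 h.
- by exists q => //; apply/eqP; rewrite -subr_eq0 opprK h.
Qed.

(** The sum is [2 p^2 - l^n] and also [l^n + 2 q^2 C]. By parity, [p^2] has degree below [n] for odd
    [n], and [q^2 C] for even [n]. *)
Lemma pell_pair_lead n p q : pell_pair a b beta n p q ->
  (p ^+ 2 + q ^+ 2 * C)`_n = (-1) ^+ n.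
Proof.
move=> [E p0 sp sq].
have -> : p ^+ 2 + q ^+ 2 * C = 2%:P * p ^+ 2 - 'X^n by rewrite -E; ring.
rewrite coefB coefCM coefXn eqxx.
have sq2 : (size (q ^+ 2 * C)%R <= n.+1)%N.
  have [->|q0] := eqVneq q 0; first by rewrite expr0n mul0r size_poly0.
  by rewrite size_sqr_cubic //; clear -sq; lia.
have [on|en] := boolP (odd n).
  rewrite nth_default ?size_sqr_poly; last by lia.
  by rewrite -signr_odd on expr1 mulr0 sub0r.
suff -> : (p ^+ 2)`_n = 1 by rewrite -signr_odd (negPf en) expr0 /=; ring.
have -> : p ^+ 2 = 'X^n + q ^+ 2 * C by rewrite -E; ring.
rewrite coefD coefXn eqxx nth_default ?addr0 //.
have [->|q0] := eqVneq q 0; first by rewrite expr0n mul0r size_poly0.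
by rewrite size_sqr_cubic //; clear -sq en; lia.
Qed.

Lemma size_confocal_form (x v : 'rV[R]_2) :
  (size (confocal_form a b x v) <= 2)%N.
Proof.
apply/leq_sizeP => -[|[|j]] // _.
by rewrite /confocal_form coefD !coefCM !coefB !coefC coefX /= subr0 !mulr0
  addr0.
Qed.

Lemma pell_periodic n p q xs vs : (0 < n)%N -> pell_pair a b beta n p q ->
    magic_trajectory a b xs vs -> caustic_level a b (xs 0) (vs 0) = beta ->
  n_periodic n xs vs.
Proof.
move=> n0 /(pell_pair_sign n0)[{}q pq pq0] T hl.
have Plead := pell_pair_lead pq.
have [E p0 sp sq] := pq.
(* [P + Q L] is the square of [p + q L], as [L^2 = C]. *)
pose P := p ^+ 2 + q ^+ 2 * C; pose Q := 2%:P * p * q.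
have EP : P = 2%:P * p ^+ 2 - 'X^n by rewrite /P -E; ring.
have PQ : P ^+ 2 - Q ^+ 2 * C = 'X^(2 * n) by rewrite mulnC exprM -E /P /Q;
  ring.
have zn : 0 ^+ n = 0 :> R by rewrite expr0n -[n == 0%N]negbK -lt0n n0.
have EP0 : P.[0] = 2 * p.[0] ^+ 2.
  by rewrite EP hornerD hornerN hornerM hornerC !horner_exp hornerX zn subr0.
have P0 : P.[0] != 0 by rewrite EP0 mulf_neq0 ?pnatr_eq0 // expf_neq0.
have PQ0 : P.[0] + Q.[0] * Num.sqrt (a * b * beta) = 0.
  rewrite EP0 /Q !hornerM hornerC.
  transitivity (2 * p.[0] * (p.[0] + q.[0] * Num.sqrt (a * b * beta)));
    first by ring.
  by rewrite {2}pq0 addNr mulr0.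
have sizeP : (size P <= n.+1)%N.
  rewrite EP; apply: leq_trans (size_polyD _ _) _.
  rewrite size_polyN size_polyXn geq_max leqnn andbT.
  rewrite mul_polyC size_scale ?pnatr_eq0 // size_sqr_poly.
  by clear -sp; lia.
have sizeQ : (size Q <= n.-1)%N.
  rewrite /Q -mulrA mul_polyC size_scale ?pnatr_eq0 //.
  apply: leq_trans (size_polyMleq _ _) _.
  have : (size p + size q <= n)%N by clear -sp sq; lia.
  by rewrite -!subn1; exact: leq_sub2r.
have [W HW dW] := pell_monodromy n0 PQ P0 PQ0 T hl (leqnn n).
have [hdet _ hax hav hbx hbv hsize [l00 l10 l11] _] := HW.
have [Z eZ] := mxdvdP (monic_neq0 (monicXn _ _)) dW.
set M := pell_mx _ _ _ _ in eZ.
have X0 : 'X^(2 * n) != 0 :> {poly R} by rewrite monic_neq0 ?monicXn.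
have MZW : M = Z *m W.
  have /matrixP e : 'X^(2 * n) *: M = 'X^(2 * n) *: (Z *m W).
    by rewrite scalemxAl -eZ -mulmxA mul_adj2_mx hdet mul_mx_scalar.
  apply/matrixP => i j; apply: (mulfI X0).
  by move: (e i j); rewrite [LHS]mxE [RHS]mxE.
pose g := confocal_form a b (xs 0) (vs 0).
pose k := confocal_form a b (vs 0) (vs 0).
pose h := confocal_form a b (xs 0) (xs 0) - (a%:P - 'X) * (b%:P - 'X).
have ME : M = mx2 (P - Q * g) (Q * h) (- (Q * k)) (P + Q * g).
  exact: pell_mxE.
clearbody M.
have sizeQf (f : {poly R}) : (size f <= 3)%N -> (size (Q * f)%R <= n.+1)%N.
  move=> sf; apply: leq_trans (size_polyMleq _ _) _.
  by clear -sizeQ sf n0; lia.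
have sizeQf2 (f : {poly R}) : (size f <= 2)%N -> (Q * f)`_n = 0.
  move=> sf; rewrite nth_default //; apply: leq_trans (size_polyMleq _ _) _.
  by clear -sizeQ sf n0; lia.
have sg : (size g <= 2)%N := size_confocal_form _ _.
have sk : (size k <= 2)%N := size_confocal_form _ _.
have sh : (size h <= 3)%N.
  apply: leq_trans (size_polyD _ _) _; rewrite geq_max size_polyN.
  rewrite (leq_trans (size_confocal_form _ _)) //=.
  apply: leq_trans (size_polyMleq _ _) _.
  have lin (c : R) : size (c%:P - 'X) = 2%N.
    by rewrite -opprB size_polyN size_XsubC.
  by rewrite !lin.
have sM i j : (size (M i j) <= n.+1)%N.
  have sDQ (f : {poly R}) : (size f <= 3)%N -> (size (P + Q * f)%R <= n.+1)%N.
    by move=> sf; apply: leq_trans (size_polyD _ _) _;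
      rewrite geq_max sizeP sizeQf.
  rewrite ME mxE; do 2 case: ifP => _.
  - by rewrite -mulrN sDQ // size_polyN ltnW.
  - exact: sizeQf.
  - by rewrite size_polyN sizeQf // ltnW.
  - by rewrite sDQ // ltnW.
have sW i j : (size (W i j) <= n.+1)%N by apply/leq_sizeP => m nm; exact: hsize.
have M00 : (M 0 0)`_n = (-1) ^+ n by rewrite ME mxE /= coefB sizeQf2 // subr0.
have M10 : (M 1 0)`_n = 0 by rewrite ME mxE /= coefN sizeQf2 // oppr0.
have M11 : (M 1 1)`_n = (-1) ^+ n by rewrite ME mxE /= coefD sizeQf2 // addr0.
have XZ i j : 'X^(2 * n) * Z i j = (M *m adj2 W) i j by rewrite eZ mxE.
(* [M] and [adj2 W] have degree at most [n], so the quotient of their product by [l^(2 n)] is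
   constant. *)
have sZ i j : Z i j = (((M *m adj2 W) i j)`_(n + n))%:P.
  rewrite -XZ addnn -mul2n coefXnM ltnn subnn.
  apply: size1_polyC; have [->|z0] := eqVneq (Z i j) 0;
    first by rewrite size_poly0.
  have : (size (('X^(2 * n) : {poly R}) * Z i j)%R <= (2 * n).+1)%N.
    rewrite XZ mxE; apply: (big_ind (fun f : {poly R} => size f <= (2 *
      n).+1)%N).
    - by rewrite size_poly0.
    - by move=> f f' sf sf'; apply: leq_trans (size_polyD _ _) _;
        rewrite geq_max sf.
    - move=> l _; apply: leq_trans (size_polyMleq _ _) _.
      have sA : (size (adj2 W l j) <= n.+1)%N.
        by rewrite mxE; do 2 case: ifP => _; rewrite ?size_polyN.
      rewrite -subn1 leq_subLR; apply: leq_trans (leq_add (sM i l) sA) _.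
      by clear; lia.
  by rewrite size_monicM ?monicXn // size_polyXn addSn /= -[X in (_ <=
    X)%N]addn1 leq_add2l.
(* The known leading coefficients of [M] and [W] determine every entry of [Z] but this one. *)
pose tau := (Z 0 1)`_0.
have ZE : Z = shear tau.
  have Mi i j : (M *m adj2 W) i j = M i 0 * adj2 W 0 j + M i 1 * adj2 W 1 j.
    by rewrite [M]mx2_eta [adj2 W]mx2_eta mul_mx2 !mxE; do 2 case: ifP.
  have sN (f : {poly R}) : (size f <= n.+1)%N -> (size (- f)%R <= n.+1)%N
    by rewrite size_polyN.
  rewrite [Z]mx2_eta /shear; congr mx2; rewrite ?[LHS]sZ.
  - rewrite Mi coefD !mxE /= !coefM_top // ?sN // M00 coefN l10 l11.
    by rewrite oppr0 mulr0 addr0 -exprD addnn -signr_odd odd_double.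
  - by rewrite /tau sZ coefC.
  - rewrite Mi coefD !mxE /= !coefM_top // ?sN // M10 coefN l10.
    by rewrite oppr0 mulr0 mul0r addr0.
  - rewrite Mi coefD !mxE /= !coefM_top // ?sN // M10 M11 l00.
    by rewrite mul0r add0r -exprD addnn -signr_odd odd_double.
have Ca : C.[a] = 0 by rewrite /confocal_cubic !hornerM !hornerD hornerN
  hornerC hornerX subrr !mul0r.
have Cb : C.[b] = 0.
  by rewrite /confocal_cubic !hornerM !hornerD !hornerN !hornerC hornerX subrr
    mulr0 mul0r.
have PE l : C.[l] = 0 -> P.[l] = l ^+ n.
  move=> Cl; have /(congr1 (horner^~ l)) := E.
  rewrite /P !hornerD hornerN [(q ^+ 2 * _).[_]]hornerM Cl hornerXn !mulr0
    subr0 addr0 => <-.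
  by [].
have hE l : h.[l] = xs 0 0 0 * xs 0 0 0 * (b - l) + xs 0 0 1 * xs 0 0 1 * (a -
  l)
    - (a - l) * (b - l).
  by rewrite /h hornerD horner_confocal_form hornerN hornerM !hornerD !hornerN
    !hornerC hornerX.
have rows l : [/\ P.[l] - Q.[l] * g.[l] = (W 0 0).[l] + tau * (W 1 0).[l],
    Q.[l] * h.[l] = (W 0 1).[l] + tau * (W 1 1).[l],
    - (Q.[l] * k.[l]) = (W 1 0).[l] & P.[l] + Q.[l] * g.[l] = (W 1 1).[l]].
  have e := MZW; rewrite ME ZE /shear [W]mx2_eta mul_mx2 in e.
  have [e1 e2 e3 e4] := mx2_inj e.
  split.
  - by rewrite -hornerM -hornerN -hornerD e1 mul1r hornerD hornerM hornerC.
  - by rewrite -hornerM e2 mul1r hornerD hornerM hornerC.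
  - by rewrite -hornerM -hornerN e3 mul0r mul1r add0r.
  - by rewrite -hornerM -hornerD e4 mul0r mul1r add0r.
have an : a ^+ n != 0 by rewrite expf_neq0 ?gt_eqF.
have bn : b ^+ n != 0 by rewrite expf_neq0 ?gt_eqF.
have ga l : g.[l] = xs 0 0 0 * vs 0 0 0 * (b - l) + xs 0 0 1 * vs 0 0 1 * (a -
  l).
  exact: horner_confocal_form.
have ka l : k.[l] = vs 0 0 0 * vs 0 0 0 * (b - l) + vs 0 0 1 * vs 0 0 1 * (a -
  l).
  exact: horner_confocal_form.
(* At [l = a] the Lax matrix kills the vector of first coordinates, so [P + Q L] acts on it as
   [P.[a] = a ^+ n]; likewise for [b] and the second coordinates. *)
have va : vs n 0 0 = vs 0 0 0.
  apply: (mulfI an); rewrite -hav -(PE a Ca).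
  have [_ _ <- <-] := rows a; rewrite ga ka; ring.
have vb : vs n 0 1 = vs 0 0 1.
  apply: (mulfI bn); rewrite -hbv -(PE b Cb).
  have [_ _ <- <-] := rows b; rewrite ga ka; ring.
have xa : xs 0 0 0 = xs n 0 0 + tau * vs n 0 0.
  apply: (mulfI an); transitivity (a ^+ n * xs n 0 0 + tau * (a ^+ n * vs n 0
    0)).
    rewrite -hav -hax -(PE a Ca).
    transitivity (((W 0 0).[a] + tau * (W 1 0).[a]) * xs 0 0 0 +
      ((W 0 1).[a] + tau * (W 1 1).[a]) * vs 0 0 0); last by ring.
    have [<- <- _ _] := rows a; rewrite ga hE; ring.
  by ring.
have xb : xs 0 0 1 = xs n 0 1 + tau * vs n 0 1.
  apply: (mulfI bn); transitivity (b ^+ n * xs n 0 1 + tau * (b ^+ n * vs n 0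
    1)).
    rewrite -hbv -hbx -(PE b Cb).
    transitivity (((W 0 0).[b] + tau * (W 1 0).[b]) * xs 0 0 1 +
      ((W 0 1).[b] + tau * (W 1 1).[b]) * vs 0 0 1); last by ring.
    have [<- <- _ _] := rows b; rewrite ga hE; ring.
  by ring.
have rv_eq (u w : 'rV[R]_2) : u 0 0 = w 0 0 -> u 0 1 = w 0 1 -> u = w.
  move=> e0 e1; apply/rowP => -[[|[|//]] i2].
  - by move: e0; congr (_ = _); congr (_ _ _); apply: val_inj.
  - by move: e1; congr (_ = _); congr (_ _ _); apply: val_inj.
have ev : vs n = vs 0 by apply: rv_eq.
have ex : xs 0 = xs n + tau *: vs n by apply: rv_eq; rewrite !mxE.
(* [tau >= 0] because the velocity after the last hit, which exists as [n > 0], points inwards and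
   [xs 0] is in the domain. *)
split=> //; exists tau => //.
have [d0 u0] := magic_invariant hb hab 0 T.
have [m en] : exists m, n = m.+1 by exists n.-1; rewrite prednK.
have [t [c [N B]]] := magic_bounce hb hab m T; rewrite -en in B.
have un : dot (vs n) (vs n) = 1 by rewrite ev.
apply: (inward_chord hb hab (bounce_ellipse hb hab B) (bounce_inward hb hab B)
  un).
by rewrite -ex.
Qed.

End PellToPeriodic.

(** * Reversal of the polynomials *)

Section ReversedPolynomials.
Variable R : numFieldType.
Implicit Types (p q : {poly R}) (m : nat) (s : R).

(** The reciprocal polynomial relative to a nominal degree [m], which may exceed the degree of
    [p]. *)
Definition rev_poly m p : {poly R} := \poly_(i < m.+1) p`_(m - i).

Lemma size_rev_poly m p : (size (rev_poly m p) <= m.+1)%N.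
Proof. exact: size_poly. Qed.

Lemma size_rev_polyE m p : p.[0] != 0 -> size (rev_poly m p) = m.+1.
Proof. by move=> p0; rewrite size_poly_eq //= subnn -horner_coef0. Qed.

Lemma rev_poly_at0 m p : (rev_poly m p).[0] = p`_m.
Proof. by rewrite horner_coef0 coef_poly /= subn0. Qed.

Lemma horner_rev_poly m p s : (size p <= m.+1)%N -> s != 0 ->
  (rev_poly m p).[s] = s ^+ m * p.[s^-1].
Proof.
move=> sp s0; rewrite horner_poly (horner_coef_wide _ sp) big_distrr /=.
rewrite (reindex_inj rev_ord_inj) /=; apply: eq_bigr => i _.
have im : (i <= m)%N by rewrite -ltnS.
rewrite subSS subKn // mulrCA; congr (_ * _).
by rewrite exprVn -expfB_cond ?(negPf s0).
Qed.

Lemma eq_horner_neq0 p q : (forall s, s != 0 -> p.[s] = q.[s]) -> p = q.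
Proof.
move=> E; apply/eqP; rewrite -subr_eq0; apply: contraT => r0.
pose rs : seq R := [seq i.+1%:R | i <- iota 0 (size (p - q))].
have := max_poly_roots r0 (_ : all (root (p - q)) rs) (_ : uniq rs).
rewrite size_map size_iota ltnn; apply.
- apply/allP => _ /mapP[i _ ->].
  by rewrite /root hornerD hornerN E ?pnatr_eq0 // subrr.
- by rewrite map_inj_uniq ?iota_uniq // => i j /eqP; rewrite eqr_nat => /eqP[].
Qed.

End ReversedPolynomials.

(** * The Pell equations in [l] and in [s = 1/l] *)

Section PellReversal.
Variables (R : realType) (a b beta : R).
Hypotheses (ha : 0 < a) (hb : 0 < b) (hbeta : 0 < beta).
Notation C := (confocal_cubic a b beta).
Implicit Types p q : {poly R}.

Let w := Num.sqrt (a * b * beta).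

Let w_gt0 : 0 < w. Proof. by rewrite sqrtr_gt0 !mulr_gt0. Qed.

Let w2 : w ^+ 2 = a * b * beta.
Proof. by rewrite sqr_sqrtr // !mulr_ge0 // ltW. Qed.

Definition rev_cubic : {poly R} :=
  ('X - (a^-1)%:P) * ('X - (b^-1)%:P) * ('X - (beta^-1)%:P).

Lemma horner_rev_cubic s : s != 0 ->
  s ^+ 3 * C.[s^-1] = w ^+ 2 * rev_cubic.[s].
Proof.
move=> s0; rewrite w2 /rev_cubic /confocal_cubic.
rewrite !hornerM !hornerXsubC !hornerD !hornerN !hornerC hornerX.
by field; rewrite s0 !gt_eqF.
Qed.

(** This gives the reversed [q] its exact degree. *)
Lemma pell_pair_q0 n p q : (0 < n)%N -> pell_pair a b beta n p q -> q.[0] != 0.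
Proof.
move=> n0 [E p0 _ _]; apply: contraNneq p0 => q0.
have /(congr1 (horner^~ 0)) := E.
rewrite hornerD hornerN [(q ^+ 2 * _).[_]]hornerM !horner_exp q0 hornerX.
rewrite !expr0n -[n == 0%N]negbK -lt0n n0 mul0r subr0 => /eqP.
by rewrite expf_eq0.
Qed.

(** The equation is multiplied by [s^(2 m)]. Since [s^3 C(1/s)] is [w^2] times [rev_cubic], the
    factor [w] goes into [q], and one factor [s] is left with the cubic. *)
Lemma even_pell_pair m : (0 < m)%N ->
  (exists p q, pell_pair a b beta (2 * m) p q) <->
  (exists p q : {poly R}, [/\ has_degree p m%:Z, has_degree q (m%:Z - 2)
     & p ^+ 2 - 'X * rev_cubic * q ^+ 2 = 1]).
Proof.
move=> m0; split=> [[p [q pq]]|[p [q [dp dq E]]]].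
- have [E p0 sp sq] := pq.
  have q0 : q.[0] != 0 by apply: pell_pair_q0 pq; rewrite muln_gt0.
  case: m m0 E sp sq {pq} => [//|[|m]] _ E sp sq.
    (* For [m = 1] the size bound leaves only [q = 0]. *)
    have qE : q = 0.
      by apply/eqP; rewrite -size_poly_eq0; clear -sq; lia.
    by rewrite qE horner0 eqxx in q0.
  have sp' : (size p <= m.+3)%N by clear -sp; lia.
  have sq' : (size q <= m.+1)%N by clear -sq; lia.
  exists (rev_poly m.+2 p), (w *: rev_poly m q); split.
  + by rewrite /has_degree /= size_rev_polyE // -addn1.
  + have -> : m.+2%:Z - 2 = m%:Z by lia.
    rewrite /has_degree /= size_scale ?gt_eqF // size_rev_polyE //.
    by rewrite -addn1.
  + apply: eq_horner_neq0 => s s0.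
    rewrite hornerD hornerN [('X * _ * _).[_]]hornerM [('X * _).[_]]hornerM.
    rewrite hornerX !horner_exp hornerZ hornerC.
    rewrite !horner_rev_poly //.
    transitivity (s ^+ (2 * m.+2) * (p.[s^-1] ^+ 2) -
      s * (s ^+ m * q.[s^-1]) ^+ 2 * (w ^+ 2 * rev_cubic.[s])).
      by rewrite mulnC exprM; ring.
    rewrite -horner_rev_cubic //.
    transitivity (s ^+ (2 * m.+2) * (p ^+ 2 - q ^+ 2 * C).[s^-1]).
      rewrite hornerD hornerN [(q ^+ 2 * _).[_]]hornerM !horner_exp.
      by rewrite mulnC exprM -addn2 exprD; ring.
    by rewrite E hornerXn -exprMn mulfV // expr1n.
- case: m m0 dp dq => [//|[|m]] _ dp dq.
    (* For [m = 1] the degree of [q] is negative, so [p^2 = 1], which is impossible in degree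
       [1]. *)
    move: dq; rewrite /has_degree /= => q0.
    move: dp E; rewrite q0 /has_degree expr0n mulr0 subr0 /= => - [sp] E.
    by have := congr1 (fun f : {poly R} => size f) E;
      rewrite size_sqr_poly sp size_poly1.
  have sp : size p = m.+3 by move: dp; rewrite /has_degree /= => -[->]; lia.
  have sq : size q = m.+1.
    have e : m.+2%:Z - 2 = m%:Z by lia.
    by move: dq; rewrite e /has_degree /= => -[->]; lia.
  exists (rev_poly m.+2 p), (w^-1 *: rev_poly m q); split.
  + apply: eq_horner_neq0 => s s0.
    rewrite hornerD hornerN [(_ * C).[_]]hornerM !horner_exp hornerZ.
    rewrite !horner_rev_poly ?sp ?sq // hornerX.
    have s0' : s^-1 != 0 by rewrite invr_eq0.
    have := horner_rev_cubic s0'; rewrite invrK => eC.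
    have w0 : w != 0 by rewrite gt_eqF.
    have -> : C.[s] = s ^+ 3 * (w ^+ 2 * rev_cubic.[s^-1]).
      by rewrite -eC mulrA -exprMn mulfV // expr1n mul1r.
    have /(congr1 (horner^~ s^-1)) := E.
    rewrite hornerD hornerN [('X * _ * _).[_]]hornerM [('X * _).[_]]hornerM.
    rewrite hornerX !horner_exp hornerC => E1.
    transitivity (s ^+ (2 * m.+2) * (p.[s^-1] ^+ 2 -
      s^-1 * rev_cubic.[s^-1] * q.[s^-1] ^+ 2)); last by rewrite E1 mulr1.
    rewrite mulnC exprM -addn2 exprD; field.
    by rewrite s0 w0.
  + by rewrite rev_poly_at0 -[m.+2]/(m.+3.-1) -sp -lead_coefE lead_coef_eq0
      -size_poly_eq0 sp.
  + apply: (@leq_trans m.+3.*2); last by clear; lia.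
    by rewrite leq_double size_rev_poly.
  + rewrite size_scale ?invr_eq0 ?gt_eqF //.
    apply: (@leq_ltn_trans m.+1.*2); last by clear; lia.
    by rewrite leq_double size_rev_poly.
Qed.

(** Here the factor [s] left over from [s^(2 m + 1)] goes with [p^2]. *)
Lemma odd_pell_pair m :
  (exists p q, pell_pair a b beta (2 * m + 1) p q) <->
  (exists p q : {poly R}, [/\ has_degree p m%:Z, has_degree q (m%:Z - 1)
     & 'X * p ^+ 2 - rev_cubic * q ^+ 2 = 1]).
Proof.
split=> [[p [q pq]]|[p [q [dp dq E]]]].
- have [E p0 sp sq] := pq.
  have q0 : q.[0] != 0 by apply: pell_pair_q0 pq; rewrite addn1.
  case: m E sp sq {pq} => [|m] E sp sq.
    have qE : q = 0.
      by apply/eqP; rewrite -size_poly_eq0; clear -sq; lia.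
    by rewrite qE horner0 eqxx in q0.
  have sp' : (size p <= m.+2)%N by clear -sp; lia.
  have sq' : (size q <= m.+1)%N by clear -sq; lia.
  exists (rev_poly m.+1 p), (w *: rev_poly m q); split.
  + by rewrite /has_degree /= size_rev_polyE // -addn1.
  + have -> : m.+1%:Z - 1 = m%:Z by lia.
    rewrite /has_degree /= size_scale ?gt_eqF // size_rev_polyE //.
    by rewrite -addn1.
  + apply: eq_horner_neq0 => s s0.
    rewrite hornerD hornerN [('X * _).[_]]hornerM [(rev_cubic * _).[_]]hornerM.
    rewrite hornerX !horner_exp hornerZ hornerC.
    rewrite !horner_rev_poly //.
    transitivity (s ^+ (2 * m.+1 + 1) * (p.[s^-1] ^+ 2) -
      (s ^+ m * q.[s^-1]) ^+ 2 * (w ^+ 2 * rev_cubic.[s])).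
      by rewrite exprD mulnC exprM; ring.
    rewrite -horner_rev_cubic //.
    transitivity (s ^+ (2 * m.+1 + 1) * (p ^+ 2 - q ^+ 2 * C).[s^-1]).
      rewrite hornerD hornerN [(q ^+ 2 * _).[_]]hornerM !horner_exp.
      by rewrite exprD mulnC exprM [s ^+ m.+1]exprS; ring.
    by rewrite E hornerXn -exprMn mulfV // expr1n.
- case: m dp dq => [|m] dp dq.
    (* For [m = 0] the polynomial [q] is zero and [s p^2 = 1] fails at [s = 0]. *)
    move: dq; rewrite /has_degree /= => q0.
    move: dp E; rewrite q0 /has_degree expr0n mulr0 subr0 /= => - [sp] E.
    have /(congr1 (horner^~ 0)) := E.
    by rewrite hornerM hornerX mul0r hornerC => /eqP; rewrite eq_sym oner_eq0.
  have sp : size p = m.+2 by move: dp; rewrite /has_degree /= => -[->]; lia.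
  have sq : size q = m.+1.
    have e : m.+1%:Z - 1 = m%:Z by lia.
    by move: dq; rewrite e /has_degree /= => -[->]; lia.
  exists (rev_poly m.+1 p), (w^-1 *: rev_poly m q); split.
  + apply: eq_horner_neq0 => s s0.
    rewrite hornerD hornerN [(_ * C).[_]]hornerM !horner_exp hornerZ.
    rewrite !horner_rev_poly ?sp ?sq // hornerX.
    have s0' : s^-1 != 0 by rewrite invr_eq0.
    have := horner_rev_cubic s0'; rewrite invrK => eC.
    have w0 : w != 0 by rewrite gt_eqF.
    have -> : C.[s] = s ^+ 3 * (w ^+ 2 * rev_cubic.[s^-1]).
      by rewrite -eC mulrA -exprMn mulfV // expr1n mul1r.
    have /(congr1 (horner^~ s^-1)) := E.
    rewrite hornerD hornerN [('X * _).[_]]hornerM [(rev_cubic * _).[_]]hornerM.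
    rewrite hornerX !horner_exp hornerC => E1.
    transitivity (s ^+ (2 * m.+1 + 1) * (s^-1 * p.[s^-1] ^+ 2 -
      rev_cubic.[s^-1] * q.[s^-1] ^+ 2)); last by rewrite E1 mulr1.
    rewrite exprD mulnC exprM [s ^+ m.+1]exprS; field.
    by rewrite s0 w0.
  + by rewrite rev_poly_at0 -[m.+1]/(m.+2.-1) -sp -lead_coefE lead_coef_eq0
      -size_poly_eq0 sp.
  + apply: (@leq_trans m.+2.*2); last by clear; lia.
    by rewrite leq_double size_rev_poly.
  + rewrite size_scale ?invr_eq0 ?gt_eqF //.
    apply: (@leq_ltn_trans m.+1.*2); last by clear; lia.
    by rewrite leq_double size_rev_poly.
Qed.

End PellReversal.

Theorem corollary3p16 (R : realType) (a b beta : R) (n : nat)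
    (hb : 0 < b) (hab : b < a)
    (hbeta : 0 < beta < b \/ b < beta < a)
    (hn : (0 < n)%N) :
  (forall x v : nat -> 'rV[R]_2,
     magic_trajectory a b x v -> has_caustic a b beta x v ->
     n_periodic n x v)
  <->
  exists p q : {poly R},
    (forall m : nat, n = (2 * m)%N ->
       [/\ has_degree p m%:Z,
           has_degree q (m%:Z - 2)
         & p ^+ 2 - 'X * ('X - (a^-1)%:P) * ('X - (b^-1)%:P)
             * ('X - (beta^-1)%:P) * q ^+ 2 = 1]) /\
    (forall m : nat, n = (2 * m + 1)%N ->
       [/\ has_degree p m%:Z,
           has_degree q (m%:Z - 1)
         & 'X * p ^+ 2 - ('X - (a^-1)%:P) * ('X - (b^-1)%:P)
             * ('X - (beta^-1)%:P) * q ^+ 2 = 1]).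
Proof.
have h0 : 0 < beta by case: hbeta => /andP[] // bb _; exact: lt_trans hb bb.
have ba : beta < a by case: hbeta => /andP[] // _ bb; exact: lt_trans bb hab.
have ha : 0 < a := lt_trans hb hab.
have na : beta != a by rewrite lt_eqF.
have nb : beta != b.
  by case: hbeta => /andP[h1 h2]; [rewrite lt_eqF | rewrite gt_eqF].
pose pell := exists p q, pell_pair a b beta n p q.
have periodicE : (forall x v : nat -> 'rV[R]_2, magic_trajectory a b x v ->
    has_caustic a b beta x v -> n_periodic n x v) <-> pell.
  split=> [H|[p [q pq]] xs vs T hc].
    (* Periodicity of this one trajectory already yields the Pell pair, which in turn makes every
       trajectory with caustic [beta] periodic. *)
    have [xs [vs [T hl x0 x1 [v0 v1]]]] := vertex_trajectory hb hab h0 ba.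
    apply: (periodic_pell hb hab h0 ba hn T) => //; apply: H => // k.
    have [_ uk] := magic_invariant hb hab k T.
    by apply/tangent_confocalP => //; rewrite (magic_caustic_level hb hab).
  apply: (pell_periodic hb hab h0 hn pq T).
  have [_ u0] := magic_invariant hb hab 0 T.
  by apply/tangent_confocalP => //; exact: hc.
apply: (iff_trans periodicE).
have [on|en] := boolP (odd n).
- have en : n = (2 * n./2 + 1)%N
    by rewrite -{1}(odd_double_half n) on mul2n addnC.
  have := odd_pell_pair ha hb h0 n./2; rewrite -en /rev_cubic => pellE.
  apply: (iff_trans pellE); split=> -[p [q h]]; exists p, q.
    split=> m em; first by rewrite em mul2n odd_double in on.
    have -> : m = n./2 by clear -en em; lia.
    by [].
  have [_ /(_ _ en)[]] := h.
  by [].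
- have {}en : n = (2 * n./2)%N.
    by rewrite -{1}(odd_double_half n) (negPf en) mul2n.
  have m0 : (0 < n./2)%N by clear -en hn; lia.
  have := even_pell_pair ha hb h0 m0; rewrite -en /rev_cubic => pellE.
  apply: (iff_trans pellE); split=> -[p [q h]]; exists p, q.
    split=> m em; last by exfalso; clear -en em; lia.
    have -> : m = n./2 by clear -en em; lia.
    by case: h => h1 h2 h3; split=> //; rewrite -h3; ring.
  have [/(_ _ en)[h1 h2 h3] _] := h.
  by split=> //; rewrite -h3; ring.
Qed.
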